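(* The decision problem SEQUENCE-B-COLORING is NP-complete. Here SEQUENCE-B-COLORING is the following problem. Instance: an infinite non-increasing sequence $S=(s_1,s_2,\dots)$ of positive integers for which there is an integer $q$ such that $s_i=1$ for all $i>q$, a graph $G$, and an integer $k$. Question: is $\varphi_S(G)\ge k$, that is, does $G$ realize $(s_1,\dots,s_r)$ for some $r\ge k$?
   Context: Graphs are finite, simple and connected. Given a proper coloring of a graph $G$, a vertex $v$ is a color-dominating vertex (CDV) if its closed neighborhood $N[v]$ contains all colors used in the coloring. A b-coloring is a proper coloring in which every color class contains at least one CDV. A graph $G$ realizes a finite sequence $(s_1,\dots,s_r)$ of positive integers if $G$ has a b-coloring with exactly $r$ colors in which, for each $i\in\{1,\dots,r\}$, the $i$th color class contains at least $s_i$ CDVs. For an infinite sequence $S$, $\varphi_S(G)$ is the maximum $r$ such that $G$ realizes $(s_1,\dots,s_r)$ (defined when at least one such $r$ exists). The sequence $S$ in an instance is determined by the finite data $q$ and $s_1,\dots,s_q$. *)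

(* Defs.v *)
From HB Require Import structures.
From mathcomp Require Import all_boot all_order all_algebra.

Set Implicit Arguments.
Unset Strict Implicit.
Unset Printing Implicit Defensive.

Inductive move := MoveLeft | Stay | MoveRight.

(* The blank symbol is [None].  A machine has [tm_tapes.+1] two-way infinite
   tapes; the input is on tape [ord0] and the output on tape [ord_max], which
   are the same tape when [tm_tapes = 0]. *)
Record tm (A B : finType) := TM {
  tm_tapes : nat;
  tm_state : finType;
  tm_sym : finType;
  tm_in : A -> tm_sym;
  tm_in_inj : injective tm_in;
  tm_out : B -> tm_sym;
  tm_out_inj : injective tm_out;
  tm_init : tm_state;
  tm_halt : pred tm_state;
  tm_delta : tm_state -> {ffun 'I_tm_tapes.+1 -> option tm_sym} ->
    tm_state * {ffun 'I_tm_tapes.+1 -> option tm_sym * move}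
}.

(* [(l, r)] is the tape whose cells left of the head are [l], nearest first,
   and whose cells from the head rightwards are [r]; all others are blank. *)
Definition tape (G : Type) := (seq (option G) * seq (option G))%type.

Definition tape_read (G : Type) (t : tape G) : option G := head None t.2.

Definition tape_act (G : Type) (a : option G * move) (t : tape G) : tape G :=
  match a.2 with
  | MoveLeft => (behead t.1, head None t.1 :: a.1 :: behead t.2)
  | Stay => (t.1, a.1 :: behead t.2)
  | MoveRight => (a.1 :: t.1, behead t.2)
  end.

Section Run.
Variables (A B : finType) (M : tm A B).

Definition config : Type :=
  (tm_state M * {ffun 'I_(tm_tapes M).+1 -> tape (tm_sym M)})%type.

Definition tm_start (w : seq A) : config :=
  (tm_init M,
   [ffun i => if i == ord0 then ([::], [seq Some (tm_in M a) | a <- w])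
              else ([::], [::])]).

Definition tm_step (c : config) : config :=
  if tm_halt c.1 then c else
  let d := tm_delta c.1 [ffun i => tape_read (c.2 i)] in
  (d.1, [ffun i => tape_act (d.2 i) (c.2 i)]).

(* Halting configurations are fixed by [tm_step], so "halts in at most t steps"
   is "is halted after t iterations".  The output is read from the head of the
   output tape rightwards, and must be followed by blanks only. *)
Definition tm_outputs_in (t : nat) (w : seq A) (v : seq B) : Prop :=
  let c := iter t tm_step (tm_start w) in
  tm_halt c.1 /\
  exists m, (c.2 ord_max).2 = [seq Some (tm_out M b) | b <- v] ++ nseq m None.

End Run.

Definition language (A : finType) := seq A -> Prop.

Definition polytime (A B : finType) (f : seq A -> seq B) : Prop :=
  exists (M : tm A B) (p : {poly nat}),
    forall w, tm_outputs_in M p.[size w]%R w (f w).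

Definition in_P (A : finType) (L : language A) : Prop :=
  exists2 d : seq A -> bool,
    polytime (fun w => [:: d w]) & forall w, L w <-> d w.

(* A pair of an input [w] over [A] and a certificate [u] over [bool] is written
   as a word over the disjoint union [A + bool]. *)
Definition pair_word (A : finType) (w : seq A) (u : seq bool) :
  seq (A + bool)%type := map inl w ++ map inr u.

Definition in_NP (A : finType) (L : language A) : Prop :=
  exists (V : language (A + bool)%type) (p : {poly nat}), in_P V /\
    forall w, L w <->
      exists2 u : seq bool, size u <= p.[size w]%R & V (pair_word w u).

Definition poly_reduces (A B : finType) (L : language A) (L' : language B) :
  Prop :=
  exists2 f : seq A -> seq B, polytime f & forall w, L w <-> L' (f w).

Definition NP_hard (B : finType) (L : language B) : Prop :=
  forall (A : finType) (L' : language A), in_NP L' -> poly_reduces L' L.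

Definition NP_complete (B : finType) (L : language B) : Prop :=
  in_NP L /\ NP_hard L.

(* Colors and sequences are indexed from 0: color [i : 'I_r] goes with [s i],
   which is the term s_(i+1) of the sequence. *)

Section Coloring.
Variables (T : finType) (e : rel T).

Definition simple_graph : Prop := symmetric e /\ irreflexive e.

Definition connected_graph : Prop :=
  0 < #|T| /\ forall x y, connect e x y.

Definition closed_nbhd (v : T) : {set T} := [set w | (w == v) || e v w].

Section ColoringWith.
Variables (r : nat) (c : {ffun T -> 'I_r}).

Definition proper_coloring : bool :=
  [forall x, forall y, e x y ==> (c x != c y)].

Definition used_colors : {set 'I_r} := c @: [set: T].

Definition CDV : {set T} :=
  [set v | used_colors \subset c @: closed_nbhd v].

Definition color_class (i : 'I_r) : {set T} := [set v | c v == i].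

Definition b_coloring : bool :=
  proper_coloring &&
  [forall i in used_colors, color_class i :&: CDV != set0].

End ColoringWith.

Definition realizes (s : nat -> nat) (r : nat) : bool :=
  [exists c : {ffun T -> 'I_r},
    [&& b_coloring c, used_colors c == [set: 'I_r] &
        [forall i : 'I_r, s i <= #|color_class c i :&: CDV c|]]].

(* phi_s(G) is defined and equal to [r]. *)
Definition is_phi (s : nat -> nat) (r : nat) : Prop :=
  realizes s r /\ forall r', realizes s r' -> r' <= r.

Lemma realizes_le_card s r : realizes s r -> r <= #|T|.
Proof.
case/existsP=> c /and3P[_ /eqP used _].
have <-: #|used_colors c| = r by rewrite used cardsT card_ord.
by rewrite (leq_trans (leq_imset_card _ _)) // cardsT.
Qed.

Lemma phi_geP s (k : int) :
  (exists2 r, is_phi s r & (k <= r%:Z)%R) <->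
  (exists2 r, realizes s r & (k <= r%:Z)%R).
Proof.
split=> [[r [sr _] kr]|[r sr kr]]; first by exists r.
have exr : exists r, realizes s r by exists r.
case: (ex_maxnP exr (@realizes_le_card s)) => m sm max_m.
by exists m => //; apply: Order.POrderTheory.le_trans kr _; apply: max_m.
Qed.

End Coloring.

Record instance := Instance {
  inst_s : nat -> nat;
  inst_s_gt0 : forall i, 0 < inst_s i;
  inst_s_noninc : forall i j, i <= j -> inst_s j <= inst_s i;
  inst_q : nat;
  inst_s_tail : forall i, inst_q <= i -> inst_s i = 1;
  inst_n : nat;
  inst_e : rel 'I_inst_n;
  inst_simple : simple_graph inst_e;
  inst_connected : connected_graph inst_e;
  inst_k : int
}.

Definition yes_instance (I : instance) : Prop :=
  exists2 r, is_phi (@inst_e I) (inst_s I) r & (inst_k I <= r%:Z)%R.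

(* Binary representation, least significant bit first; the first argument of
   [bits_rec] is fuel. *)
Fixpoint bits_rec (m n : nat) : seq bool :=
  if m is m'.+1 then
    if n == 0 then [::] else odd n :: bits_rec m' n./2
  else [::].

Definition bits (n : nat) : seq bool := bits_rec n n.

Definition bits_int (k : int) : seq bool := (k < 0)%R :: bits `|k|%N.

Definition adj_rows (n : nat) (e : rel 'I_n) : seq (seq bool) :=
  [seq [seq e i j | j <- enum 'I_n] | i <- enum 'I_n].

(* Words are sequences over {0, 1, #}, with # written [None]. *)
Definition join_words (ws : seq (seq bool)) : seq (option bool) :=
  flatten [seq rcons [seq Some b | b <- w] None | w <- ws].

(* The rows of the adjacency matrix are nonempty, so that the empty word marks
   the end of the matrix; [inst_n] and [inst_q] can be read off by counting. *)
Definition encode (I : instance) : seq (option bool) :=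
  join_words (bits_int (inst_k I) :: adj_rows (@inst_e I) ++
              [::] :: [seq bits (inst_s I i) | i <- iota 0 (inst_q I)]).

Definition sequence_b_coloring : language (option bool) :=
  fun w => exists2 I : instance, w = encode I & yes_instance I.

Definition unbits (s : seq bool) : nat :=
  foldr (fun (b : bool) n => b + n.*2) 0 s.

Lemma bitsK : cancel bits unbits.
Proof.
suff rec m n : n <= m -> unbits (bits_rec m n) = n by move=> n; apply: rec.
elim: m n => [|m IHm] n; first by rewrite leqn0 => /eqP ->.
case: n => [|n] // le_nm; rewrite [bits_rec _ _]/= [unbits _]/= IHm.
  by rewrite -[in RHS](odd_double_half n.+1).
by rewrite leq_uphalf_double -addnn -ltnS (leq_trans le_nm) ?ltnS ?leq_addr.
Qed.

Lemma bits_int_inj : injective bits_int.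
Proof.
move=> k l [sgn /(can_inj bitsK) abs_kl].
by rewrite (intEsign k) (intEsign l) sgn abs_kl.
Qed.

Lemma join_words_inj : injective join_words.
Proof.
elim=> [|w ws IHw] [|v vs] //.
- by case: v.
- by case: w.
rewrite /join_words /= -/(join_words ws) -/(join_words vs) => eq_wv.
suff [-> /IHw ->] : w = v /\ join_words ws = join_words vs by [].
elim: w v eq_wv {IHw} => [|b w IHw] [|a v] //=; first by case.
by case=> -> /IHw[-> ->].
Qed.

Lemma size_adj_rows n (e : rel 'I_n) : size (adj_rows e) = n.
Proof. by rewrite size_map size_enum_ord. Qed.

Lemma adj_rows_inj n (e e' : rel 'I_n) : adj_rows e = adj_rows e' -> e =2 e'.
Proof.
move=> eq_rows i j.
have /eq_in_map/(_ i (mem_enum _ i)) eq_row := eq_rows.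
by have /eq_in_map/(_ j (mem_enum _ j)) := eq_row.
Qed.

Lemma nil_adj_rows n (e : rel 'I_n) : [::] \notin adj_rows e.
Proof.
apply/mapP=> -[i _] /(congr1 size); rewrite size_map size_enum_ord => n0.
by case: i => m; rewrite -n0.
Qed.

Lemma encode_inj (I J : instance) : encode I = encode J ->
  [/\ inst_k I = inst_k J, inst_n I = inst_n J,
      adj_rows (@inst_e I) = adj_rows (@inst_e J),
      inst_q I = inst_q J & inst_s I =1 inst_s J].
Proof.
move/join_words_inj=> [sgn abs_k eq_ws].
have split_nil (r r' t t' : seq (seq bool)) : [::] \notin r -> [::] \notin r' ->
    r ++ [::] :: t = r' ++ [::] :: t' -> r = r' /\ t = t'.
  elim: r r' => [|x r IHr] [|y r'] //=.
  - by move=> _ _ [].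
  - by rewrite inE negb_or => _ /andP[/eqP ny _] [].
  - by rewrite inE negb_or => /andP[/eqP nx _] _ [/esym].
  rewrite !inE !negb_or => /andP[_ nr] /andP[_ nr'] [-> eq_r].
  by have [-> ->] := IHr _ nr nr' eq_r.
have [eq_rows eq_s] := split_nil _ _ _ _
  (nil_adj_rows (@inst_e I)) (nil_adj_rows (@inst_e J)) eq_ws.
have eq_q: inst_q I = inst_q J.
  by move/(congr1 size): eq_s; rewrite !size_map !size_iota.
split=> //.
- by apply: bits_int_inj; rewrite /bits_int sgn abs_k.
- by rewrite -(size_adj_rows (@inst_e I)) eq_rows size_adj_rows.
move=> i; have [lt_iq|le_qi] := ltnP i (inst_q I); last first.
  by rewrite !inst_s_tail // -eq_q.
apply: (can_inj bitsK); move: eq_s; rewrite -eq_q => /eq_in_map; apply.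
by rewrite mem_iota.
Qed.

(* Main.v *)
(* Hardness. A computation of a polynomial-time verifier on an input
   followed by an unknown certificate is a table of columns, where column j
   at time t + 1 depends only on columns 0, j - 1, j and j + 1 at time t.
   Letting each cell (t, j) choose these four columns gives a constraint
   satisfaction problem with binary conflicts over a fixed domain. It is
   turned into a graph with exactly k vertices of degree at least k - 1, so
   that a b-coloring with at least k colors has exactly k colors and all
   these vertices are color-dominating, with distinct colors; one of them,
   tau, is not adjacent to the vertex of a cell, which must thus see the
   color of tau on one of the tokens that stand for the choices at that
   cell, while conflicting tokens are adjacent. The sequence is constantly
   1.

   Membership. The certificate is the coloring.

   Polynomial time. Values are coded as binary trees on top of a stack, and
   the functions computed in polynomial time by machines that only touch the
   top of the stack are closed under composition, pairing, tests and bounded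
   iteration; both the reduction and the verifier are written with these
   operations. *)

Require Import Defs.
From mathcomp Require Import all_boot all_order all_algebra.
From mathcomp Require Import zify.
From Stdlib Require Import FunctionalExtensionality.

Set Implicit Arguments.
Unset Strict Implicit.
Unset Printing Implicit Defensive.

(** * Stack machines *)

(** A step of a tableau links up to five cells, whereas edges of a graph express only binary
    conflicts. A cell therefore guesses copies of the columns it depends on; apart from conditions
    on a single cell, each conflict compares what one cell guesses, or computes from its guesses,
    with the column held by one other cell. Folding every tape at its head removes the head
    positions from the table, and the windows form a finite type that depends only on the verifier,
    so that the reduction can treat every test on windows as a constant table.

    The terms of the sequence and the bound [k] are written in binary and may be exponential in the
    length of the word, while numbers are coded in unary by the polynomial-time machines. The
    verifier hence never evaluates them: it writes its own counts, which are at most the number of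
    vertices, in binary and compares words.

    Stacks are used because a machine that only looks at the tops cannot notice what lies below. An
    intermediate result can thus be kept under the working data while any other machine runs, and
    composition needs no relocation of data. *)

Inductive ix := I0 | I1 | I2.

Section Machines.
Variable X : finType.

(* [inl (Some true)] and [inl (Some false)] are the symbols of tree codes,
   [inl None] is a marker. *)
Definition sg : finType := (option bool + X)%type.

Definition stk := (seq sg * seq sg * seq sg)%type.

Definition get (s : stk) (i : ix) : seq sg :=
  match i with I0 => s.1.1 | I1 => s.1.2 | I2 => s.2 end.

Definition upd (s : stk) (i : ix) (v : seq sg) : stk :=
  match i with
  | I0 => (v, s.1.2, s.2) | I1 => (s.1.1, v, s.2) | I2 => (s.1.1, s.1.2, v)
  end.

Definition tops (s : stk) (i : ix) : option sg := ohead (get s i).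

(* [Some (i, Some x)] pushes [x] on stack [i] and [Some (i, None)] pops it. *)
Definition action := option (ix * option sg).

Definition do_action (a : action) (s : stk) : stk :=
  match a with
  | Some (i, Some x) => upd s i (x :: get s i)
  | Some (i, None) => upd s i (behead (get s i))
  | None => s
  end.

(* A stack machine exits by moving to [None]. *)
Record frag := Frag {
  fstate : finType;
  finit : fstate;
  fdelta : fstate -> (ix -> option sg) -> option fstate * action
}.

Inductive run_from (F : frag) : option (fstate F) -> stk -> nat -> stk ->
  Prop :=
| RunExit s : run_from None s 0 s
| RunStep q s t s' :
    run_from (fdelta q (tops s)).1 (do_action (fdelta q (tops s)).2 s) t s' ->
    run_from (Some q) s t.+1 s'.

Definition runs (F : frag) (s : stk) (t : nat) (s' : stk) : Prop :=
  exists2 t', t' <= t & run_from (Some (finit F)) s t' s'.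

Lemma runsW F s t u s' : runs F s t s' -> t <= u -> runs F s u s'.
Proof. by case=> t' tt' r tu; exists t' => //; apply: leq_trans tu. Qed.

Lemma size_run F q s t s' : @run_from F q s t s' ->
  size s'.1.1 <= size s.1.1 + t.
Proof.
elim=> {q s t s'} [s|q s t s' _]; first by rewrite addn0.
move/leq_trans; apply; rewrite addnS -addSn leq_add2r.
case: (fdelta q (tops s)).2 => [[[] [x|]]|] //=; rewrite ?size_behead; lia.
Qed.

Lemma size_runs F s t s' : runs F s t s' -> size s'.1.1 <= size s.1.1 + t.
Proof. by case=> t' le_t /size_run/leq_trans -> //; rewrite leq_add2l. Qed.

Definition prim (a : (ix -> option sg) -> action) : frag :=
  @Frag unit tt (fun _ o => (None, a o)).

Lemma runs_prim a s : runs (prim a) s 1 (do_action (a (tops s)) s).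
Proof. by exists 1 => //; apply: RunStep; apply: RunExit. Qed.

Definition push i x := prim (fun=> Some (i, Some x)).
Definition pop i := prim (fun=> Some (i, None)).
Definition skip := prim (fun=> None).
Definition copy i j := prim (fun o => omap (fun x => (j, Some x)) (o i)).

Definition fseq (F G : frag) : frag :=
  @Frag (fstate F + fstate G)%type (inl (finit F)) (fun q o =>
    match q with
    | inl q => let d := fdelta q o in
               (Some (if d.1 is Some q' then inl q' else inr (finit G)), d.2)
    | inr q => let d := fdelta q o in (omap inr d.1, d.2)
    end).

Lemma runs_seq F G s a s1 b s2 :
  runs F s a s1 -> runs G s1 b s2 -> runs (fseq F G) s (a + b) s2.
Proof.
case=> t ta r1 [u ub r2]; exists (t + u); first exact: leq_add.
have {}r2 : @run_from (fseq F G) (Some (inr (finit G))) s1 u s2.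
  rewrite -[Some (inr _)]/(omap inr (Some (finit G))).
  elim: r2 => [s0|q s0 v s3 _ IH]; first exact: RunExit.
  exact: (@RunStep (fseq F G)).
have gen q : run_from q s t s1 -> @run_from (fseq F G)
    (Some (if q is Some q' then inl q' else inr (finit G))) s (t + u) s2.
  move=> r; elim: r r2 => [s0|q' s0 v s3 _ IH] // r2.
  by rewrite addSn; apply: (@RunStep (fseq F G)); apply: IH.
exact: gen r1.
Qed.

Definition ifte (c : (ix -> option sg) -> bool) (F G : frag) : frag :=
  @Frag (option (fstate F + fstate G)) None (fun q o =>
    match q with
    | None => (Some (Some (if c o then inl (finit F) else inr (finit G))), None)
    | Some (inl q) => let d := fdelta q o in (omap (Some \o inl) d.1, d.2)
    | Some (inr q) => let d := fdelta q o in (omap (Some \o inr) d.1, d.2)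
    end).

Lemma runs_ifte c F G s a s' :
  (if c (tops s) then runs F s a s' else runs G s a s') ->
  runs (ifte c F G) s a.+1 s'.
Proof.
case: ifP => cs [t ta r]; (exists t.+1 => //); apply: RunStep; rewrite /= cs.
  have ->: Some (Some (inl (finit F))) =
      omap (Some \o (@inl (fstate F) (fstate G))) (Some (finit F)) by [].
  elim: r {cs} => [s0|q s0 v s3 _ IH]; first exact: RunExit.
  exact: (@RunStep (ifte c F G)).
have ->: Some (Some (inr (finit G))) =
    omap (Some \o (@inr (fstate F) (fstate G))) (Some (finit G)) by [].
elim: r {cs} => [s0|q s0 v s3 _ IH]; first exact: RunExit.
exact: (@RunStep (ifte c F G)).
Qed.

Definition whil (c : (ix -> option sg) -> bool) (F : frag) : frag :=
  @Frag (option (fstate F)) None (fun q o =>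
    match q with
    | None => (if c o then Some (Some (finit F)) else None, None)
    | Some q => let d := fdelta q o in (Some d.1, d.2)
    end).

Lemma runs_whil_exit c F s : ~~ c (tops s) -> runs (whil c F) s 1 s.
Proof.
move=> /negPf cs; exists 1 => //; apply: RunStep => /=; rewrite cs.
exact: RunExit.
Qed.

Lemma runs_whil_step (c : (ix -> option sg) ->
  bool) F s a s1 b s2 : c (tops s) ->
  runs F s a s1 -> runs (whil c F) s1 b s2 -> runs (whil c F) s (a + b).+1 s2.
Proof.
move=> cs [t ta r1] [u ub r2]; exists (t + u).+1; first by rewrite ltnS leq_add.
apply: RunStep; rewrite /= cs /=.
have gen q : run_from q s t s1 -> @run_from (whil c F) (Some q) s (t + u) s2.
  move=> r; elim: r r2 => [s0|q' s0 v s3 _ IH] // r2.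
  by rewrite addSn; apply: (@RunStep (whil c F)); apply: IH.
exact: gen r1.
Qed.

End Machines.
Arguments push {X} i x.
Arguments pop {X} i.
Arguments skip {X}.
Arguments copy {X} i j.

(** * Polynomial-time functions on codes of trees *)

Inductive tree := Leaf | Node of tree & tree.

(** Preorder traversal is a prefix-free code: the end of a tree on top of a stack is found by
    counting the subtrees still to come, without a separator. *)
Fixpoint code (t : tree) : seq bool :=
  if t is Node l r then true :: code l ++ code r else [:: false].

(** * Moving, copying and discarding coded trees *)

Section TreeOperations.
Variable X : finType.
Implicit Type t : tree.

Definition bit (b : bool) : sg X := inl (Some b).
Definition mark : sg X := inl None.
Definition tw t : seq (sg X) := map bit (code t).

Lemma size_tw t : size (tw t) = size (code t).
Proof. exact: size_map. Qed.

(* Stack 2 holds one marker for every tree that remains to be scanned. *)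
Definition scan : frag X :=
  whil (fun o => o I2 == Some mark)
    (fseq (copy I0 I1)
      (fseq (ifte (fun o => o I0 == Some (bit true)) (push I2 mark) (pop I2))
        (pop I0))).

Lemma runs_scan_bit b s0 s1 s2 u s' :
  runs scan (s0, bit b :: s1, if b then [:: mark, mark & s2] else s2) u s' ->
  runs scan (bit b :: s0, s1, mark :: s2) (5 + u) s'.
Proof.
move=> r; apply: (@runs_whil_step _ _ _ _ 4 _ _ _ _ _ r) => //.
apply: (runs_seq (runs_prim _ _)).
set s2' := if b then _ else _.
apply: (@runs_seq _ _ _ _ 2 (bit b :: s0, bit b :: s1, s2') 1).
  by apply: runs_ifte; rewrite {}/s2'; case: b {r}; apply: runs_prim.
exact: runs_prim.
Qed.

(** The run on the remainder is a premise, so that the induction passes from the left subtree to the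
    right one inside the same loop. *)
Lemma runs_scan t s0 s1 s2 u s' :
  runs scan (s0, rev (tw t) ++ s1, s2) u s' ->
  runs scan (tw t ++ s0, s1, mark :: s2) (5 * size (code t) + u) s'.
Proof.
elim: t s0 s1 s2 u => [|l IHl r IHr] s0 s1 s2 u run.
  exact: runs_scan_bit.
rewrite /tw /= map_cat -/(tw l) -/(tw r) -catA size_cat mulnS -addnA.
apply: runs_scan_bit; rewrite mulnDr -addnA; apply: IHl; apply: IHr.
by move: run; rewrite /tw /= map_cat rev_cons rev_cat cat_rcons catA.
Qed.

(** The tree arrives on stack 1 reversed. Read backwards a code is no longer prefix-free, so a
    marker below it shows where it ends. *)
Definition stash := fseq (push I1 mark) (fseq (push I2 mark) scan).

Lemma runs_stash t s0 s1 :
  runs stash (tw t ++ s0, s1, [::]) (5 * size (code t) + 3)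
    (s0, rev (tw t) ++ mark :: s1, [::]).
Proof.
have end_scan : runs scan (s0, rev (tw t) ++ mark :: s1, [::]) 1
    (s0, rev (tw t) ++ mark :: s1, [::]) by apply: runs_whil_exit.
eapply runsW.
  apply: (runs_seq (runs_prim _ _)); apply: (runs_seq (runs_prim _ _)).
  exact: runs_scan end_scan.
lia.
Qed.

(** The common form of all loops that consume a word from a stack: [st] gives the stacks from an
    accumulator and the unread rest, and the terminator [z] is a marker or, as [None], the bottom of
    the stack. *)
Lemma runs_each (A : Type) (st : A -> seq (sg X) -> stk X)
    (g : A -> sg X -> A) (i : ix) (z : option (sg X)) (F : frag X) k a v :
  z \notin map some v ->
  (forall a v, tops (st a v) i = if v is x :: _ then Some x else z) ->
  (forall a x v, runs F (st a (x :: v)) k (st (g a x) v)) ->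
  runs (whil (fun o => o i != z) F) (st a v) (k.+1 * size v + 1)
    (st (foldl g a v) [::]).
Proof.
move=> + top body; elim: v a => [|x v IH] a.
  by move=> _; rewrite muln0; apply: runs_whil_exit; rewrite top eqxx.
rewrite inE negb_or mulnS -addnA addSn => /andP[nx nv].
by apply: (runs_whil_step _ (body _ _ _) (IH _ nv)); rewrite top eq_sym.
Qed.

Lemma mark_tw t : Some mark \notin map some (tw t).
Proof. by rewrite -map_comp; apply/mapP => -[]. Qed.

Lemma mark_rev_tw t : Some mark \notin map some (rev (tw t)).
Proof. by rewrite map_rev mem_rev mark_tw. Qed.

Lemma foldl_cons (s v : seq (sg X)) : foldl (fun u x =>
  x :: u) s v = rev v ++ s.
Proof. by rewrite -catrevE; elim: v s => //= x v IH s; rewrite IH. Qed.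

Definition unstash :=
  fseq (whil (fun o => o I1 != Some mark) (fseq (copy I1 I0) (pop I1)))
    (pop I1).

Lemma runs_unstash t s0 s1 :
  runs unstash (s0, rev (tw t) ++ mark :: s1, [::]) (3 * size (code t) + 2)
    (tw t ++ s0, s1, [::]).
Proof.
have := @runs_each _ (fun u v => (u, v ++ mark :: s1, [::]))
  (fun u x => x :: u) I1 (Some mark) (fseq (copy I1 I0) (pop I1)) 2 s0
  (rev (tw t)) (mark_rev_tw t).
rewrite foldl_cons revK size_rev size_tw => r.
apply: runsW (runs_seq (r _ _) (runs_prim _ _)) _ => [u [|x v] //|u x v|].
  by apply: (runs_seq (runs_prim _ _) (runs_prim _ _)).
lia.
Qed.

(** The first loop restores the tree on stack 0 and puts a second copy on the empty stack 2; this
    copy goes back above the marker, from where [unstash] lays it over the first. *)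
Definition dup :=
  fseq stash
    (fseq (whil (fun o => o I1 != Some mark)
             (fseq (copy I1 I0) (fseq (copy I1 I2) (pop I1))))
      (fseq (whil (fun o => o I2 != None) (fseq (copy I2 I1) (pop I2)))
        unstash)).

Lemma runs_dup t s0 s1 :
  runs dup (tw t ++ s0, s1, [::]) (15 * size (code t) + 7)
    (tw t ++ tw t ++ s0, s1, [::]).
Proof.
have r1 := runs_stash t s0 s1.
have := @runs_each _ (fun u v => (u ++ s0, v ++ mark :: s1, u))
  (fun u x => x :: u) I1 (Some mark)
  (fseq (copy I1 I0) (fseq (copy I1 I2) (pop I1))) 3 [::]
  (rev (tw t)) (mark_rev_tw t).
rewrite foldl_cons revK cats0 size_rev size_tw => r2.
have := @runs_each _ (fun u v => (tw t ++ s0, u, v))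
  (fun u x => x :: u) I2 None (fseq (copy I2 I1) (pop I2)) 2
  (mark :: s1) (tw t).
rewrite foldl_cons size_tw => r3.
have r4 := runs_unstash t (tw t ++ s0) s1.
apply: runsW (runs_seq r1 (runs_seq (r2 _ _) (runs_seq (r3 _ _ _) r4))) _.
- by move=> u [|x v].
- move=> u x v; apply: (runs_seq (runs_prim _ _)).
  by apply: (runs_seq (runs_prim _ _) (runs_prim _ _)).
- by apply/mapP => -[].
- by move=> u [|x v].
- by move=> u x v; apply: (runs_seq (runs_prim _ _) (runs_prim _ _)).
lia.
Qed.

Definition discard :=
  fseq stash (fseq (whil (fun o => o I1 != Some mark) (pop I1)) (pop I1)).

Lemma runs_discard t s0 s1 :
  runs discard (tw t ++ s0, s1, [::]) (7 * size (code t) + 5) (s0, s1, [::]).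
Proof.
have := @runs_each _ (fun (_ : unit) v => (s0, v ++ mark :: s1, [::]))
  (fun u _ => u) I1 (Some mark) (pop I1) 1 tt (rev (tw t)) (mark_rev_tw t).
rewrite size_rev size_tw => r.
apply: runsW (runs_seq (runs_stash t s0 s1) (runs_seq (r _ _) (runs_prim _ _)))
  _ => [u [|x v] //|u x v|]; first exact: runs_prim.
lia.
Qed.

Definition push_word i v : frag X :=
  foldr (fun x F => fseq F (push i x)) skip v.

Lemma runs_push_word i v (s : stk X) :
  runs (push_word i v) s (size v + 1) (upd s i (v ++ get s i)).
Proof.
elim: v => [|x v IH] /=.
  rewrite [X in runs _ _ _ X](_ : _ = s); first exact: runs_prim.
  by case: i s => -[[]].
rewrite (_ : upd s i _ =
  do_action (Some (i, Some x)) (upd s i (v ++ get s i))); last by case: i {IH}.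
eapply runsW; first exact: runs_seq IH (runs_prim _ _).
by rewrite addn1.
Qed.

End TreeOperations.

(** * Codes of data types and polynomial bounds *)

Structure ctype := CType { csort :> Type; enc : csort -> tree }.
Arguments enc {c} x : rename.

(** Unary, so that a number is bounded by the size of its code and can count iterations of a
    polynomial-time loop. *)
Fixpoint enc_nat (n : nat) : tree :=
  if n is n'.+1 then Node Leaf (enc_nat n') else Leaf.

Definition enc_bool (b : bool) : tree := if b then Node Leaf Leaf else Leaf.

Fixpoint enc_seq (T : ctype) (s : seq T) : tree :=
  if s is x :: s' then Node (enc x) (enc_seq s') else Leaf.

Canonical tree_ctype := CType (@id tree).
Canonical nat_ctype := CType enc_nat.
Canonical bool_ctype := CType enc_bool.
Canonical seq_ctype (T : ctype) := CType (@enc_seq T).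
Canonical prod_ctype (S T : ctype) :=
  CType (fun p : S * T => Node (enc p.1) (enc p.2)).
Canonical fin_ctype (D : finType) :=
  CType (fun d : D => enc_nat (enum_rank d)).

Definition sz (T : ctype) (x : T) : nat := size (code (enc x)).

Lemma sz_gt0 (T : ctype) (x : T) : 0 < sz x.
Proof. by rewrite /sz; case: (enc x). Qed.

Lemma sz_pair (S T : ctype) (x : S) (y : T) : sz (x, y) = (sz x + sz y).+1.
Proof. by rewrite /sz /= size_cat. Qed.

(** The base is at least 2, so constants, sums and products are absorbed by a larger exponent and a
    bound is a single number. *)
Definition pbound (T : nat -> nat) := exists k, forall n, T n <= n.+2 ^ k.

Lemma pbound_le T U : (forall n, T n <= U n) -> pbound U -> pbound T.
Proof. by move=> le_TU [k Uk]; exists k => n; apply: leq_trans (Uk n). Qed.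

Lemma pbound_exp k : pbound (fun n => n.+2 ^ k).
Proof. by exists k. Qed.

Lemma pbound_id : pbound id.
Proof. by exists 1 => n; rewrite expn1; apply: ltnW. Qed.

Lemma leq_expl e m n : m <= n -> m ^ e <= n ^ e.
Proof. by case: e => // e le_mn; rewrite leq_exp2r. Qed.

Lemma pbound_const c : pbound (fun=> c).
Proof.
exists c => n; apply: leq_trans (leq_expl c (isT : 2 <= n.+2)).
exact: ltnW (ltn_expl c (isT : 1 < 2)).
Qed.

Lemma pbound_mul T U : pbound T -> pbound U -> pbound (fun n => T n * U n).
Proof.
by move=> [k Tk] [l Ul]; exists (k + l) => n; rewrite expnD leq_mul.
Qed.

Lemma pbound_add T U : pbound T -> pbound U -> pbound (fun n => T n + U n).
Proof.
move=> [k Tk] [l Ul]; exists (k + l).+1 => n; rewrite expnS expnD.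
have: 0 < n.+2 ^ k by rewrite expn_gt0.
have: 0 < n.+2 ^ l by rewrite expn_gt0.
move: (Tk n) (Ul n); set a := n.+2 ^ k; set b := n.+2 ^ l => ? ? ? ?.
apply: (@leq_trans (a + b)); first exact: leq_add.
apply: (@leq_trans (2 * (a * b))); first by nia.
by rewrite leq_mul2r orbT.
Qed.

Lemma pbound_S T : pbound T -> pbound (fun n => (T n).+1).
Proof. by move=> bT; apply: pbound_add (pbound_const 1) bT. Qed.

Lemma pbound_powr T k : pbound T -> pbound (fun n => T n ^ k).
Proof. by move=> [l Tl]; exists (l * k) => n; rewrite expnM leq_expl. Qed.

#[local] Hint Resolve pbound_exp pbound_id pbound_const pbound_mul pbound_add
  pbound_S pbound_powr : core.

Definition tws (X : finType) (T : ctype) (x : T) : seq (sg X) := tw X (enc x).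

(* [PF f] says that [f] is computed in polynomial time by a stack machine that
   replaces [x] on top of stack 0 by [f x].  The rest of stacks 0 and 1 is
   preserved, which is what makes such machines compose.  The alphabet may have
   further symbols. *)
Definition PF (S T : ctype) (f : S -> T) : Prop :=
  forall X : finType, exists (F : frag X) (k : nat), forall x s0 s1,
    runs F (tws X x ++ s0, s1, [::]) ((sz x).+2 ^ k) (tws X (f x) ++ s0, s1,
      [::]).

Lemma PF_intro (S T : ctype) (f : S -> T) :
  (forall X : finType, exists (F : frag X) (t : nat -> nat), pbound t /\
     forall x s0 s1, runs F (tws X x ++ s0, s1, [::]) (t (sz x))
       (tws X (f x) ++ s0, s1, [::])) -> PF f.
Proof.
move=> Ff X; have [F [t [[k tk] r]]] := Ff X.
by exists F, k => x s0 s1; apply: runsW (r _ _ _) (tk _).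
Qed.

(** A step pushes at most one symbol, so the running time bounds the growth of stack 0, where the
    result is left. This keeps the time of a composition polynomial. *)
Lemma sz_PF (S T : ctype) (f : S -> T) : PF f ->
  exists k, forall x, (sz (f x)).+2 <= (sz x).+2 ^ k.
Proof.
case/(_ void)=> F [k r].
suff [l bl] : pbound (fun n => (n + n.+2 ^ k).+2).
  exists l => x; apply: leq_trans (bl _); rewrite !ltnS.
  have /size_runs := r x [::] [::].
  by rewrite /= !cats0 !size_tw.
by auto.
Qed.

Lemma PF_ext (S T : ctype) (f g : S -> T) : f =1 g -> PF f -> PF g.
Proof.
by move=> fg Pf X; have [F [k r]] := Pf X; exists F, k => x; rewrite -fg.
Qed.

(** Data may be reread in another type with the same codes at no cost: a nonempty list is coded like
    the pair of its head and tail, and a number like a list of [false]. *)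
Lemma PF_cast (S T : ctype) (f : S -> T) :
  (forall x, enc (f x) = enc x) -> PF f.
Proof.
move=> ef; apply: PF_intro => X; exists skip, (fun=> 1); split=> // x s0 s1.
by rewrite /tws ef; apply: runs_prim.
Qed.

Lemma PF_id (T : ctype) : PF (fun x : T => x).
Proof. exact: PF_cast. Qed.

Lemma PF_comp (S T U : ctype) (g : T -> U) (f : S -> T) :
  PF g -> PF f -> PF (fun x => g (f x)).
Proof.
move=> Pg Pf; have [m szf] := sz_PF Pf; apply: PF_intro => X.
have [F [k rF]] := Pf X; have [G [l rG]] := Pg X.
exists (fseq F G), (fun n => n.+2 ^ k + (n.+2 ^ m) ^ l); split=> [|x s0 s1].
  by auto.
apply: runs_seq (rF _ _ _) (runsW (rG _ _ _) _).
exact: leq_expl.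
Qed.

Lemma PF_const (S T : ctype) (c : T) : PF (fun _ : S => c).
Proof.
apply: PF_intro => X.
exists (fseq (discard X) (push_word I0 (tws X c))).
exists (fun n => 7 * n + 5 + (sz c + 1)); split=> [|x s0 s1]; first by auto.
apply: runs_seq (runs_discard _ _ _) _.
rewrite /sz -(size_tw X (enc c)); exact: (runs_push_word I0 _ (s0, s1, [::])).
Qed.

Lemma PF_pair (S T U : ctype) (f : S -> T) (g : S -> U) :
  PF f -> PF g -> PF (fun x => (f x, g x)).
Proof.
move=> Pf Pg; have [m szf] := sz_PF Pf; apply: PF_intro => X.
have [F [k rF]] := Pf X; have [G [l rG]] := Pg X.
exists (fseq (dup X) (fseq F (fseq (stash X) (fseq G (fseq (unstash X)
  (push I0 (bit X true))))))).
exists (fun n => (15 * n + 7) + (n.+2 ^ k + ((5 * n.+2 ^ m + 3) + (n.+2 ^ l +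
  ((3 * n.+2 ^ m + 2) + 1))))).
split=> [|x s0 s1]; first by auto 20.
have szfx : sz (f x) <= (sz x).+2 ^ m by apply: leq_trans (szf x); lia.
apply: runs_seq (runs_dup _ _ _) _.
apply: runs_seq (rF _ _ _) _.
apply: (@runs_seq _ _ _ _ _ (tws X x ++ s0, rev (tws X (f x)) ++ mark X :: s1,
  [::])).
  by apply: runsW (runs_stash _ _ _) _; rewrite leq_add2r leq_mul2l.
apply: runs_seq (rG _ _ _) _.
apply: (@runs_seq _ _ _ _ _ (tws X (f x) ++ tws X (g x) ++ s0, s1, [::])).
  by apply: runsW (runs_unstash _ _ _) _; rewrite leq_add2r leq_mul2l.
rewrite [tws X (f x, g x)]/tws /= /tw /= map_cat -catA.
exact: (@runs_prim X (fun=> Some (I0, Some (bit X true)))).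
Qed.

Lemma PF_fst (S T : ctype) : PF (fun p : S * T => p.1).
Proof.
apply: PF_intro => X.
exists (fseq (pop I0) (fseq (stash X) (fseq (discard X) (unstash X)))).
exists (fun n => 1 + (5 * n + 3 + (7 * n + 5 + (3 * n + 2)))).
split=> [|[x y] s0 s1]; first by auto 20.
apply: runs_seq (runs_prim _ _) _.
rewrite sz_pair /= map_cat -catA -[map _ _]/(tws X x) -[map _ (code (enc y))]/(tws X y).
apply: (@runs_seq _ _ _ _ _ (tws X y ++ s0, rev (tws X x) ++ mark X :: s1,
  [::])).
  apply: runsW (runs_stash _ _ _) _; rewrite -/(sz x); lia.
apply: (@runs_seq _ _ _ _ _ (s0, rev (tws X x) ++ mark X :: s1, [::])).
  apply: runsW (runs_discard _ _ _) _; rewrite -/(sz y); lia.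
apply: runsW (runs_unstash _ _ _) _; rewrite -/(sz x); lia.
Qed.

Lemma PF_snd (S T : ctype) : PF (fun p : S * T => p.2).
Proof.
apply: PF_intro => X.
exists (fseq (pop I0) (discard X)).
exists (fun n => 1 + (7 * n + 5)).
split=> [|[x y] s0 s1]; first by auto 20.
apply: runs_seq (runs_prim _ _) _.
rewrite sz_pair /= map_cat -catA -[map _ _]/(tws X x) -[map _ (code (enc y))]/(tws X y).
apply: runsW (runs_discard _ _ _) _; rewrite -/(sz x); lia.
Qed.

(** The code of the boolean [true] has three symbols and that of [false] has one, hence the numbers
    of pops; the first symbol tells them apart. *)
Definition test_then X (F G H : frag X) : frag X :=
  fseq (dup X) (fseq F (ifte (fun o => o I0 == Some (bit X true))
    (fseq (pop I0) (fseq (pop I0) (fseq (pop I0) G))) (fseq (pop I0) H))).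

(** Pattern matching: once [c x] is known, the argument is reread as a value [y] of a type with the
    same code, for instance the head and tail of a list that is known to be nonempty. *)
Lemma PF_case (S S1 S2 T : ctype) (c : S -> bool) (f : S1 -> T) (g : S2 -> T)
    (h : S -> T) :
  PF c -> PF f -> PF g ->
  (forall x, if c x then exists2 y, enc y = enc x & h x = f y
             else exists2 y, enc y = enc x & h x = g y) ->
  PF h.
Proof.
move=> Pc Pf Pg hE; apply: PF_intro => X.
have [C [j rC]] := Pc X; have [F [k rF]] := Pf X; have [G [l rG]] := Pg X.
exists (test_then C F G).
exists (fun n => 15 * n + 7 + (n.+2 ^ j + (3 + n.+2 ^ k + n.+2 ^ l).+1)).
split=> [|x s0 s1]; first by auto 20.
apply: runs_seq (runs_dup _ _ _) _.
apply: runs_seq (rC _ _ _) _.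
apply: runs_ifte; rewrite {1}/tops /=.
case: (c x) (hE x) => /= -[y ey ->]; rewrite /sz -ey -/(sz y) -/(tws X y);
  eapply runsW.
- do 3 apply: (runs_seq (runs_prim _ _)); apply: rF.
- by rewrite !addnA leq_addr.
- apply: (runs_seq (runs_prim _ _)); apply: rG.
- lia.
Qed.

Lemma PF_if (S T : ctype) (c : S -> bool) (f g : S -> T) :
  PF c -> PF f -> PF g -> PF (fun x => if c x then f x else g x).
Proof.
move=> Pc Pf Pg; apply: (PF_case Pc Pf Pg) => x.
by case: (c x); exists x.
Qed.

(** Iterating a polynomial-time function can make values explode, so a bound [B] on all intermediate
    values goes with the bound [N] on the number of rounds. *)
Lemma PF_while (S : ctype) (c : S -> bool) (f h : S -> S) (N B : nat -> nat) :
  PF c -> PF f -> pbound N -> pbound B ->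
  (forall x, exists2 n, n <= N (sz x) &
    [/\ h x = iter n f x, ~~ c (h x) &
        forall i, i <= n -> (i < n -> c (iter i f x)) /\ 
                            sz (iter i f x) <= B (sz x)]) ->
  PF h.
Proof.
move=> Pc Pf pN pB spec; apply: PF_intro => X.
have [C [j rC]] := Pc X; have [F [k rF]] := Pf X.
pose L := whil (fun o => o I0 == Some (bit X true))
  (fseq (pop I0) (fseq (pop I0) (fseq (pop I0) (fseq F (fseq (dup X) C))))).
exists (fseq (dup X) (fseq C (fseq L (pop I0)))).
pose d b := 15 * b + 7 + b.+2 ^ j.
have d_mono a b : a <= b -> d a <= d b.
  by move=> le_ab; rewrite /d; apply: leq_add; [lia | apply: leq_expl].
pose e b := (3 + (b.+2 ^ k + d b)).+1.
exists (fun n => d n + ((N n * e (B n) + 1) + 1)); split=> [|x s0 s1].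
  rewrite /e /d; have pS m : pbound (fun n => (B n).+2 ^ m) by auto.
  have pE m : pbound (fun n => (B n).+2 ^ m) by auto.
  by auto 20.
have [n leN [-> ncn ok]] := spec x.
have rd y : runs (fseq (dup X) C) (tws X y ++ s0, s1, [::]) (d (sz y))
    (tws X (c y) ++ tws X y ++ s0, s1, [::]).
  by apply: runs_seq (runs_dup _ _ _) (rC _ _ _).
rewrite /d -addnA; apply: runs_seq (runs_dup _ _ _) _.
apply: runs_seq (rC _ _ _) _.
pose st y : stk X := (tws X (c y) ++ tws X y ++ s0, s1, [::]).
(* Here [i] is the number of rounds still to be run. *)
suff rL i : i <= n ->
    runs L (st (iter (n - i) f x)) (i * e (B (sz x)) + 1) (st (iter n f x)).
  have /= := rL n (leqnn n); rewrite subnn => /runsW rLn.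
  apply: runs_seq (rLn _ _) _; first by rewrite leq_add2r leq_mul2r leN orbT.
  have := @runs_prim X (fun=> Some (I0, None)) (st (iter n f x)).
  by rewrite /= (negPf ncn).
elim: i => [|i IH] lt_in.
  rewrite subn0; apply: runs_whil_exit.
  by rewrite /st; move: (ncn); case: (c _).
have [] := ok (n - i.+1) _; first by rewrite leq_subr.
rewrite {1}ltn_subrL ltn0Sn /= => /(_ (leq_ltn_trans (leq0n i) lt_in)) ci szi.
have := IH (ltnW lt_in).
rewrite (_ : n - i = (n - i.+1).+1); last by rewrite subnSK.
rewrite iterS; set y := iter _ f x in ci szi *.
have lt_n := subnSK lt_in => r.
rewrite mulSn -addnA -/e {1}/e addSn.
apply: runs_whil_step r.
  by rewrite /st ci.
rewrite /st ci; eapply runsW.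
  do 3 apply: (runs_seq (runs_prim _ _)).
  apply: runs_seq (rF _ _ _) _; apply: rd.
have [_] := ok (n - i) (leq_subr _ _).
rewrite -lt_n iterS -/y => /d_mono le_d.
have: (sz y).+2 ^ k <= (B (sz x)).+2 ^ k by rewrite leq_expl // !ltnS.
by move: le_d; lia.
Qed.

(** * Closure properties *)

(** The coding of [fin_ctype], declared for the key [option] so that inference finds it. *)
Canonical option_bool_ctype :=
  CType (fun d : option bool => enc_nat (enum_rank d)).

Lemma PF_lift (S T : ctype) (f : S -> T) (g : tree -> tree) :
  PF g -> (forall x, enc (f x) = g (enc x)) -> PF f.
Proof.
move=> Pg fg X; have [G [k r]] := Pg X; exists G, k => x s0 s1.
by rewrite /tws fg; apply: r (enc x) _ _.
Qed.

Lemma PF_comp2 (S T U V : ctype) (g : T -> U -> V) (f : S -> T) (h : S -> U) :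
  PF (fun p : T * U => g p.1 p.2) -> PF f -> PF h ->
  PF (fun x => g (f x) (h x)).
Proof. by move=> Pg Pf Ph; apply: PF_comp Pg (PF_pair Pf Ph). Qed.

Lemma PF_fst' (S T U : ctype) (f : S -> T * U) : PF f -> PF (fun x => (f x).1).
Proof. exact: PF_comp (@PF_fst T U). Qed.

Lemma PF_snd' (S T U : ctype) (f : S -> T * U) : PF f -> PF (fun x => (f x).2).
Proof. exact: PF_comp (@PF_snd T U). Qed.

Definition is_node (t : tree) : bool := if t is Node _ _ then true else false.

Lemma PF_is_node : PF is_node.
Proof.
apply: PF_intro => X.
exists (ifte (fun o => o I0 == Some (bit X true))
  (fseq (discard X) (push_word I0 (tws X true))) skip).
exists (fun n => (7 * n + 5 + 5).+1); split=> [|[|l r] s0 s1]; first by auto 20.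
  by apply: runs_ifte => /=; apply: runsW (runs_prim _ _) _.
apply: runs_ifte; rewrite {1}/tops /=; eapply runsW.
  apply: runs_seq (runs_discard (Node l r) _ _) _.
  exact: (runs_push_word I0 (tws X true) (s0, s1, [::])).
rewrite /sz /=; lia.
Qed.

Definition split_tree (t : tree) : tree * tree :=
  if t is Node l r then (l, r) else (Leaf, Leaf).

(** A node and the pair of its children have the same code. Two symbols pushed on the single [false]
    of a leaf turn it into the code of a pair of leaves. *)
Lemma PF_split_tree : PF split_tree.
Proof.
apply: PF_intro => X.
exists (ifte (fun o => o I0 == Some (bit X true)) skip
  (push_word I0 [:: bit X true; bit X false])).
exists (fun=> 4); split=> [|[|l r] s0 s1]; first by auto 20.
  apply: runs_ifte => /=.
  exact: (runs_push_word I0 [:: bit X true;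
    bit X false] (tws X Leaf ++ s0, s1, [::])).
by apply: runs_ifte; rewrite {1}/tops /=; apply: runsW (runs_prim _ _) _.
Qed.

Section ListCase.
Variables (S T : ctype).

Lemma PF_nilp : PF (fun s : seq T => nilp s).
Proof.
apply: (@PF_lift _ _ _ (fun t => if is_node t then Leaf else Node Leaf Leaf)).
  by apply: PF_if PF_is_node _ _; apply: PF_const.
by case.
Qed.

Lemma PF_cons (f : S -> T) (g : S -> seq T) :
  PF f -> PF g -> PF (fun x => f x :: g x).
Proof.
by apply: PF_comp2; apply: (PF_cast (f := fun p : T * seq T => p.1 :: p.2)).
Qed.

Lemma PF_behead (f : S -> seq T) : PF f -> PF (fun x => behead (f x)).
Proof.
apply: PF_comp; apply: (@PF_lift _ _ _ (fun t => (split_tree t).2)).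
  by apply: PF_snd'; apply: PF_split_tree.
by case.
Qed.

Lemma PF_head x0 (f : S -> seq T) : PF f -> PF (fun x => head x0 (f x)).
Proof.
apply: PF_comp; apply: (@PF_lift _ _ _
  (fun t => if is_node t then (split_tree t).1 else enc x0)).
  apply: PF_if PF_is_node _ (PF_const _ _).
  by apply: PF_fst'; apply: PF_split_tree.
by case.
Qed.

End ListCase.

Lemma PF_negb (S : ctype) (f : S -> bool) : PF f -> PF (fun x => ~~ f x).
Proof. by move=> Pf; apply: PF_if => //; apply: PF_const. Qed.

Lemma PF_andb (S : ctype) (f g : S -> bool) :
  PF f -> PF g -> PF (fun x => f x && g x).
Proof. by move=> Pf Pg; apply: PF_if => //; apply: PF_const. Qed.

Lemma PF_orb (S : ctype) (f g : S -> bool) :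
  PF f -> PF g -> PF (fun x => f x || g x).
Proof. by move=> Pf Pg; apply: PF_if => //; apply: PF_const. Qed.

Lemma PF_implb (S : ctype) (f g : S -> bool) :
  PF f -> PF g -> PF (fun x => f x ==> g x).
Proof. by move=> Pf Pg; apply: PF_if => //; apply: PF_const. Qed.

Lemma PF_eqb (S : ctype) (f g : S -> bool) :
  PF f -> PF g -> PF (fun x => f x == g x).
Proof.
move=> Pf Pg; apply: (@PF_ext _ _ (fun x => if f x then g x else ~~ g x)).
  by move=> x; case: (f x); case: (g x).
by apply: PF_if => //; apply: PF_negb.
Qed.

Section ListSize.
Variable T : ctype.
Implicit Type s : seq T.

Lemma sz_cons (x : T) s : sz (x :: s) = (sz x + sz s).+1.
Proof. by rewrite /sz /= size_cat. Qed.

Lemma sz_nil : sz ([::] : seq T) = 1.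
Proof. by []. Qed.

Lemma sz_cat s1 s2 : (sz (s1 ++ s2)).+1 = sz s1 + sz s2.
Proof. elim: s1 => [|x s1 IH] /=; rewrite ?sz_nil ?sz_cons; lia. Qed.

Lemma sz_drop n s : sz (drop n s) <= sz s.
Proof. by rewrite -{2}(cat_take_drop n s); have := sz_cat (take n s) (drop n s);
  have := sz_gt0 (take n s); lia. Qed.

Lemma sz_take n s : sz (take n s) <= sz s.
Proof. by rewrite -{2}(cat_take_drop n s); have := sz_cat (take n s) (drop n s);
  have := sz_gt0 (drop n s); lia. Qed.

Lemma size_sz s : size s < sz s.
Proof. by elim: s => [|x s IH] //; rewrite sz_cons /=; lia. Qed.

Lemma sz_rev s : sz (rev s) = sz s.
Proof.
elim: s => [|x s IH] //; rewrite rev_cons -cats1; apply: succn_inj.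
rewrite sz_cat !sz_cons sz_nil IH; lia.
Qed.

End ListSize.

Lemma sz_map (T U : ctype) (f : T -> U) (n M : nat) (s : seq T) :
  (forall x, sz x <= n -> sz (f x) <= M) -> sz s <= n ->
  sz (map f s) <= size s * M.+1 + 1.
Proof.
move=> fM; elim: s => [|x s IH] //; rewrite sz_cons /= sz_cons mulSn => le_n.
by have := IH _; have := fM x _; lia.
Qed.

(** * Folds, list operations and unary arithmetic *)

Section Fold.
Variables (S T U : ctype).

(** The size hypothesis concerns every list, in particular every prefix of [s x], and thereby bounds
    all intermediate accumulators as [PF_while] demands. *)
Lemma PF_foldl (f : S -> U -> T -> U) (a : S -> U) (s : S -> seq T) :
  PF (fun p : S * U * T => f p.1.1 p.1.2 p.2) ->
  (exists k, forall x a s, sz (foldl (f x) a s) <= (sz x + sz a + sz s).+2 ^ k) ->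
  PF a -> PF s -> PF (fun x => foldl (f x) (a x) (s x)).
Proof.
move=> Pf [k bf] Pa Ps.
pose st := (S * (U * seq T))%type.
pose step (p : st) : st :=
  if p.2.2 is y :: s' then (p.1, (f p.1 p.2.1 y, s')) else p.
pose h (p : st) : st := (p.1, (foldl (f p.1) p.2.1 p.2.2, [::])).
have Pstep : PF step.
  apply: (@PF_case _ _ (prod_ctype S (prod_ctype U (prod_ctype T (seq_ctype T))))
    _ (fun p : st => nilp p.2.2) id (fun p => (p.1, (f p.1 p.2.1 p.2.2.1,
      p.2.2.2)))).
  - by apply: PF_comp (@PF_nilp _) _; do 2 apply: PF_snd'; apply: PF_id.
  - exact: PF_id.
  - apply: PF_pair; first by apply: PF_fst'; apply: PF_id.
    apply: PF_pair; last by do 3 apply: PF_snd'; apply: PF_id.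
    apply: (PF_comp Pf (f := fun p => (p.1, p.2.1, p.2.2.1))).
    apply: PF_pair; last by apply: PF_fst'; do 2 apply: PF_snd'; apply: PF_id.
    by apply: PF_pair; last apply: PF_fst'; [apply: PF_fst|apply: PF_snd].
  - by move=> [x [b [|y l]]] /=;
      [exists (x, (b, [::])) | exists (x, (b, (y, l)))].
have Ph : PF h.
  apply: (@PF_while _ (fun p : st => ~~ nilp p.2.2) step h id
    (fun n => (2 * n + n.+2 ^ k).+2)).
  - apply: PF_negb; apply: PF_comp (@PF_nilp _) _.
    by do 2 apply: PF_snd'; apply: PF_id.
  - by [].
  - by [].
  - by auto 20.
  move=> [x [b l]]; rewrite !sz_pair; exists (size l).
    by have := size_sz l; lia.
  have it i : i <= size l -> iter i step (x, (b, l)) =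
      (x, (foldl (f x) b (take i l), drop i l)).
    elim: i => [|i IH] lt_i; first by rewrite take0 drop0.
    rewrite iterS IH ?(ltnW lt_i) // /step /=.
    case: l lt_i {IH} => // y l lt_i.
    by rewrite (drop_nth y) // (take_nth y) // foldl_rcons.
  split=> // [|i le_i]; first by rewrite it // take_size drop_size.
  rewrite it //; split=> [lt_i|];
    first by rewrite /nilp size_drop subn_eq0 -ltnNge.
  rewrite !sz_pair /=; have := sz_drop i l; have := sz_take i l => le_t le_d.
  have := bf x b (take i l) => /leq_trans.
  move=> /(_ ((sz x + (sz b + sz l).+1).+1.+2 ^ k)) szf.
  suff : sz (foldl (f x) b (take i l)) <= (sz x + (sz b + sz l).+1).+1.+2 ^ k.
    by lia.
  by apply: szf; apply: leq_expl; lia.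
apply: (PF_ext (f := fun x => (h (x, (a x, s x))).2.1)) => //.
apply: PF_fst'; apply: PF_snd'; apply: (PF_comp Ph).
by apply: PF_pair; [apply: PF_id | apply: PF_pair].
Qed.

End Fold.

Lemma foldl_flip_cons (A B : Type) (f : A -> B) s t :
  foldl (fun u x => f x :: u) t s = rev (map f s) ++ t.
Proof. by elim: s t => //= x s IH t; rewrite IH rev_cons cat_rcons. Qed.

Lemma PF_rev_map (S T U : ctype) (f : S -> T -> U) (s : S -> seq T) :
  PF (fun p : S * T => f p.1 p.2) -> PF s ->
  PF (fun x => rev [seq f x y | y <- s x]).
Proof.
move=> Pf Ps; apply: (PF_ext (f := fun x => foldl (fun u y =>
  f x y :: u) [::] (s x))).
  by move=> x; rewrite foldl_flip_cons cats0.
apply: PF_foldl => //; last exact: PF_const.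
  apply: PF_cons; last by apply: PF_snd'; apply: PF_fst.
  apply: (PF_comp Pf (f := fun p => (p.1.1, p.2))).
  by apply: PF_pair (@PF_snd _ _); apply: PF_fst'; apply: PF_fst.
have [k bf] := sz_PF Pf.
have [l bl] : pbound (fun n => n * (n.+2 ^ k).+1 + n.+1) by auto 10.
exists l => x a t; apply: leq_trans (bl _).
rewrite foldl_flip_cons; set n := sz x + _ + _.
have le_map : sz (map (f x) t) <= size t * (n.+2 ^ k).+1 + 1.
  apply: (@sz_map _ _ _ (sz t)) => // y le_y.
  apply: leq_trans (leq_trans _ (bf (x, y))) _ => //=; first by lia.
  by apply: leq_expl; rewrite sz_pair /n; have := sz_gt0 a; lia.
have := sz_cat (rev (map (f x) t)) a; rewrite sz_rev.
have : size t * (n.+2 ^ k).+1 <= n * (n.+2 ^ k).+1.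
  by rewrite leq_mul2r /n; have := size_sz t; lia.
have: sz a <= n by rewrite /n; lia.
clearbody n; lia.
Qed.

Lemma PF_rev (S T : ctype) (s : S -> seq T) : PF s -> PF (fun x => rev (s x)).
Proof.
move=> Ps; apply: (PF_ext (f := fun x => rev [seq y | y <- s x])).
  by move=> x; rewrite map_id.
by apply: PF_rev_map => //; apply: PF_snd.
Qed.

Lemma PF_map (S T U : ctype) (f : S -> T -> U) (s : S -> seq T) :
  PF (fun p : S * T => f p.1 p.2) -> PF s ->
  PF (fun x => [seq f x y | y <- s x]).
Proof.
move=> Pf Ps.
apply: (PF_ext (f := fun x => rev (rev [seq f x y | y <- s x]))).
  by move=> x; rewrite revK.
by apply: PF_rev; apply: PF_rev_map.
Qed.

Lemma PF_foldr (S T U : ctype) (f : S -> T -> U -> U) (a : S -> U) (s : S ->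
  seq T) :
  PF (fun p : S * T * U => f p.1.1 p.1.2 p.2) ->
  (exists k, forall x a s, sz (foldr (f x) a s) <= (sz x + sz a + sz s).+2 ^ k) ->
  PF a -> PF s -> PF (fun x => foldr (f x) (a x) (s x)).
Proof.
move=> Pf [k bf] Pa Ps.
apply: (PF_ext (f := fun x => foldl (fun u y => f x y u) (a x) (rev (s x)))).
  by move=> x; rewrite foldl_rev.
apply: PF_foldl => //; last exact: PF_rev.
  apply: (PF_comp Pf (f := fun p => (p.1.1, p.2, p.1.2))).
  apply: PF_pair; last by apply: PF_snd'; apply: PF_fst.
  by apply: PF_pair (@PF_snd _ _); apply: PF_fst'; apply: PF_fst.
by exists k => x b l; rewrite -(revK l) foldl_rev sz_rev; apply: bf.
Qed.

Lemma PF_cat (S T : ctype) (s t : S -> seq T) :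
  PF s -> PF t -> PF (fun x => s x ++ t x).
Proof.
move=> Ps Pt; apply: (PF_ext (f := fun x => foldr cons (t x) (s x))).
  by move=> x; elim: (s x) => //= y u ->.
apply: (@PF_foldr _ _ _ (fun _ => cons)) => //.
  by apply: PF_cons (@PF_snd _ _); apply: PF_snd'; apply: PF_fst.
exists 1 => x a u; rewrite expn1.
have e : (sz (foldr cons a u)).+1 = sz u + sz a.
  by rewrite -sz_cat; congr (sz _).+1; elim: u => //= y u ->.
by apply: ltnW; rewrite e; lia.
Qed.

Lemma PF_flatten (S T : ctype) (s : S -> seq (seq T)) :
  PF s -> PF (fun x => flatten (s x)).
Proof.
apply: (@PF_foldr _ _ _ (fun _ => cat) (fun=> [::])); last exact: PF_const.
  by apply: PF_cat; [apply: PF_snd'; apply: PF_fst | apply: PF_snd].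
exists 1 => x a u; rewrite expn1.
suff le_sz : sz (foldr cat a u) <= sz u + sz a.
  apply: leq_trans le_sz _; rewrite -addnA [sz a + _]addnC -!addSn.
  exact: leq_addl.
elim: u => [|y u IH]; first exact: leq_addl.
rewrite sz_cons /= -ltnS sz_cat addSn; do 2 apply: leqW.
by rewrite -addnA leq_add2l.
Qed.

Lemma PF_filter (S T : ctype) (p : S -> T -> bool) (s : S -> seq T) :
  PF (fun q : S * T => p q.1 q.2) -> PF s ->
  PF (fun x => [seq y <- s x | p x y]).
Proof.
move=> Pp Ps; apply: (PF_ext
  (f := fun x => flatten [seq if p x y then [:: y] else [::] | y <- s x])).
  by move=> x; elim: (s x) => //= y u ->; case: (p x y).
apply: PF_flatten; apply: PF_map => //; apply: PF_if Pp _ (PF_const _ _).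
exact: PF_cons (@PF_snd _ _) (PF_const _ _).
Qed.

Lemma PF_has (S T : ctype) (p : S -> T -> bool) (s : S -> seq T) :
  PF (fun q : S * T => p q.1 q.2) -> PF s -> PF (fun x => has (p x) (s x)).
Proof.
move=> Pp Ps; apply: (PF_ext (f := fun x => ~~ nilp [seq y <- s x | p x y])).
  by move=> x; rewrite /nilp size_filter has_count lt0n.
by apply: PF_negb; apply: (PF_comp (@PF_nilp _)); apply: PF_filter.
Qed.

Lemma PF_all (S T : ctype) (p : S -> T -> bool) (s : S -> seq T) :
  PF (fun q : S * T => p q.1 q.2) -> PF s -> PF (fun x => all (p x) (s x)).
Proof.
move=> Pp Ps; apply: (PF_ext (f := fun x => ~~ has (fun y => ~~ p x y) (s x))).
  by move=> x; rewrite -all_predC; apply: eq_all => y /=; rewrite negbK.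
by apply: PF_negb; apply: PF_has => //; apply: PF_negb.
Qed.

(* A natural number has the same code as a list of as many [false]. *)
Lemma enc_size (T : ctype) (s : seq T) :
  enc (size s) = enc [seq false | _ <- s].
Proof. by elim: s => //= x s ->. Qed.

Lemma PF_size (S T : ctype) (s : S -> seq T) :
  PF s -> PF (fun x => size (s x)).
Proof.
move=> Ps; have Pm : PF (fun x => [seq false | _ <- s x]).
  by apply: PF_map Ps; apply: PF_const.
move=> X; have [F [k r]] := Pm X; exists F, k => x s0 s1.
by rewrite /tws enc_size; apply: r.
Qed.

Lemma PF_nseq (S T : ctype) (n : S -> nat) (c : T) :
  PF n -> PF (fun x => nseq (n x) c).
Proof.
move=> Pn; apply: (PF_ext (f := fun x => [seq c | _ <- nseq (n x) false])).
  by move=> x; rewrite map_nseq.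
apply: PF_map; first exact: PF_const.
apply: (PF_comp (g := fun m => nseq m false)) => //.
by apply: PF_cast; elim=> //= m ->.
Qed.

Lemma PF_iter (S T : ctype) (f : S -> T -> T) (a : S -> T) (n : S -> nat) :
  PF (fun p : S * T => f p.1 p.2) ->
  (exists k, forall x a n, sz (iter n (f x) a) <= (sz x + sz a + n).+2 ^ k) ->
  PF a -> PF n -> PF (fun x => iter (n x) (f x) (a x)).
Proof.
move=> Pf [k bf] Pa Pn.
have itE x b (l : seq bool) :
    foldl (fun c _ => f x c) b l = iter (size l) (f x) b.
  by elim: l b => // y l IH b; rewrite /= IH -iterS iterSr.
apply: (PF_ext (f := fun x =>
    foldl (fun c (_ : bool) => f x c) (a x) (nseq (n x) false))).
  by move=> x; rewrite itE size_nseq.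
apply: PF_foldl => //; last exact: PF_nseq.
  exact: PF_comp Pf (@PF_fst _ _).
exists k => x b l; rewrite itE; apply: leq_trans (bf _ _ _) _.
apply: leq_expl; rewrite !ltnS leq_add2l; apply: ltnW; exact: size_sz.
Qed.

Lemma PF_drop (S T : ctype) (n : S -> nat) (s : S -> seq T) :
  PF n -> PF s -> PF (fun x => drop (n x) (s x)).
Proof.
have dropE m (l : seq T) : iter m behead l = drop m l.
  elim: m l => [|m IH] l; first by rewrite drop0.
  by rewrite iterSr IH; case: l => //; case: m {IH}.
move=> Pn Ps; apply: (PF_ext (f := fun x => iter (n x) behead (s x))) => //.
apply: (@PF_iter _ _ (fun _ => behead)) => //; first exact/PF_behead/PF_snd.
exists 1 => x a m; rewrite expn1 dropE.
apply: leq_trans (sz_drop m a) _; rewrite addnAC -!addSn.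
exact: leq_addl.
Qed.

Lemma PF_nth (S T : ctype) (c : T) (s : S -> seq T) (n : S -> nat) :
  PF s -> PF n -> PF (fun x => nth c (s x) (n x)).
Proof.
move=> Ps Pn; apply: (PF_ext (f := fun x => head c (drop (n x) (s x)))).
  by move=> x; rewrite -nth0 nth_drop addn0.
by apply: PF_head; apply: PF_drop.
Qed.

Lemma PF_succ (S : ctype) (m : S -> nat) : PF m -> PF (fun x => (m x).+1).
Proof.
move=> Pm; apply: (PF_ext (f := fun x => size (false :: nseq (m x) false))).
  by move=> x; rewrite /= size_nseq.
by apply: PF_size; apply: PF_cons (PF_const _ _) _; apply: PF_nseq.
Qed.

Lemma PF_addn (S : ctype) (m n : S -> nat) :
  PF m -> PF n -> PF (fun x => m x + n x).
Proof.
move=> Pm Pn; apply: (PF_ext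
  (f := fun x => size (nseq (m x) false ++ nseq (n x) false))).
  by move=> x; rewrite size_cat !size_nseq.
by apply: PF_size; apply: PF_cat; apply: PF_nseq.
Qed.

Lemma PF_subn (S : ctype) (m n : S -> nat) :
  PF m -> PF n -> PF (fun x => m x - n x).
Proof.
move=> Pm Pn; apply: (PF_ext
  (f := fun x => size (drop (n x) (nseq (m x) false)))).
  by move=> x; rewrite size_drop !size_nseq.
by apply: PF_size; apply: PF_drop; last apply: PF_nseq.
Qed.

Lemma PF_muln (S : ctype) (m n : S -> nat) :
  PF m -> PF n -> PF (fun x => m x * n x).
Proof.
move=> Pm Pn; apply: (PF_ext (f := fun x =>
    size (flatten [seq nseq (n x) false | _ <- nseq (m x) false]))).
  by move=> x; rewrite map_nseq size_flatten /shape map_nseq sumn_nseq size_nseq mulnC.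
apply: PF_size; apply: PF_flatten.
apply: (@PF_map _ _ _ (fun x _ => nseq (n x) false)); last exact: PF_nseq.
by apply: PF_nseq; apply: PF_comp Pn (@PF_fst _ _).
Qed.

Lemma PF_leq (S : ctype) (m n : S -> nat) :
  PF m -> PF n -> PF (fun x => m x <= n x).
Proof.
move=> Pm Pn; apply: (PF_ext (f := fun x => nilp (nseq (m x - n x) false))).
  by move=> x; rewrite /nilp size_nseq.
by apply: (PF_comp (@PF_nilp _)); apply: PF_nseq; apply: PF_subn.
Qed.

Lemma PF_eqn (S : ctype) (m n : S -> nat) :
  PF m -> PF n -> PF (fun x => m x == n x).
Proof.
move=> Pm Pn; apply: (PF_ext (f := fun x => (m x <= n x) && (n x <= m x))).
  by move=> x; rewrite eqn_leq.
by apply: PF_andb; apply: PF_leq.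
Qed.

Lemma PF_iota (S : ctype) (n : S -> nat) : PF n -> PF (fun x => iota 0 (n x)).
Proof.
move=> Pn; pose f (u : seq nat) := size u :: u.
have itE m : iter m f [::] = rev (iota 0 m).
  by elim: m => // m IH; rewrite iterS IH -addn1 iotaD rev_cat /f size_rev size_iota.
apply: (PF_ext (f := fun x => rev (iter (n x) f [::]))).
  by move=> x; rewrite itE revK.
apply: PF_rev; apply: (@PF_iter _ _ (fun _ => f)) => //.
- by apply: PF_cons; [apply: PF_size|]; apply: PF_snd.
- have sz_nat m : sz m = m.*2.+1.
    by rewrite /sz; elim: m => // m; rewrite doubleS /= => ->.
  have [k bk] : pbound (fun n => n * (n * 2 + 2) + n) by auto 10.
  exists k => x a m; apply: leq_trans (bk _).
  set N := _ + m; have le_N : m + size a <= N.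
    by rewrite addnC leq_add2r; apply: ltnW;
      apply: leq_trans (size_sz a) (leq_addl _ _).
  suff le_sz : sz (iter m f a) <= m * (N * 2 + 2) + sz a.
    apply: (leq_trans le_sz); apply: leq_add;
      first by rewrite leq_mul2r /N leq_addl orbT.
    by rewrite /N -addnA addnCA leq_addr.
  elim: m {k bk x}N le_N => [|m IH] N le_N; first by rewrite leq_addl.
  rewrite iterS {1}/f sz_cons sz_nat.
  have ->: size (iter m f a) = m + size a by elim: m {IH le_N} => //= m ->.
  by have := IH N _; nia.
- exact: PF_const.
Qed.

Lemma PF_count (S T : ctype) (p : S -> T -> bool) (s : S -> seq T) :
  PF (fun q : S * T => p q.1 q.2) -> PF s -> PF (fun x => count (p x) (s x)).
Proof.
move=> Pp Ps; apply: (PF_ext (f := fun x => size [seq y <- s x | p x y])).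
  by move=> x; rewrite size_filter.
by apply: PF_size; apply: PF_filter.
Qed.

Lemma PF_empty (S T : ctype) (f : S -> T) : (S -> False) -> PF f.
Proof. by move=> noS; apply: PF_cast => x; case: (noS x). Qed.

Lemma PF_rank (D : finType) : PF (fun d : D => enum_rank d : nat).
Proof. exact: PF_cast. Qed.

(** The values of [h] form a constant table, which is looked up at the rank of the argument. *)
Lemma PF_fin (D : finType) (T : ctype) (h : D -> T) : PF h.
Proof.
case E: (enum D) => [|d0 e].
  by apply: PF_empty => d; have := mem_enum D d; rewrite E.
apply: (PF_ext (f := fun d => nth (h d0) [seq h d | d <- enum D] (enum_rank d))).
  by move=> d; rewrite (nth_map d0) -?cardE // nth_enum_rank.
by apply: PF_nth (PF_const _ _) (@PF_rank D).
Qed.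

Lemma PF_fin2 (D1 D2 : finType) (T : ctype) (h : D1 -> D2 -> T) :
  PF (fun p : D1 * D2 => h p.1 p.2).
Proof.
case E1: (enum D1) => [|d1 e1].
  by apply: PF_empty => -[d _]; have := mem_enum D1 d; rewrite E1.
case E2: (enum D2) => [|d2 e2].
  by apply: PF_empty => -[_ d]; have := mem_enum D2 d; rewrite E2.
apply: (PF_ext (f := fun p => nth (h d1 d2)
    [seq h p.1 d | d <- enum D2] (enum_rank p.2))).
  by move=> p; rewrite (nth_map d2) -?cardE // nth_enum_rank.
apply: PF_nth; last by apply: (PF_comp (@PF_rank D2)); apply: PF_snd.
apply: (PF_comp (g := fun d1 => [seq h d1 d | d <- enum D2]));
  last exact: PF_fst.
exact: PF_fin.
Qed.

(* A hook for further operations, redefined below. *)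
Ltac pf_user := fail.

(** Folds and iterations are absent, since they require a size bound that has to be supplied by
    hand. *)
Ltac pf1 := lazymatch goal with
  | |- PF fst => exact: PF_fst
  | |- PF snd => exact: PF_snd
  | |- PF (fun x => x) => exact: PF_id
  | |- PF (fun _ => ?c) => exact: PF_const
  | |- PF (fun _ => (_, _)) => apply: PF_pair
  | |- PF (fun _ => if _ then _ else _) => apply: PF_if
  | |- PF (fun _ => (_).1) => apply: PF_fst'
  | |- PF (fun _ => (_).2) => apply: PF_snd'
  | |- PF (fun _ => cons _ _) => apply: PF_cons
  | |- PF (fun _ => behead _) => apply: PF_behead
  | |- PF (fun _ => head _ _) => apply: PF_head
  | |- PF (fun _ => nth _ _ _) => apply: PF_nth
  | |- PF (fun _ => negb _) => apply: PF_negb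
  | |- PF (fun _ => andb _ _) => apply: PF_andb
  | |- PF (fun _ => orb _ _) => apply: PF_orb
  | |- PF (fun _ => implb _ _) => apply: PF_implb
  | |- PF (fun _ => rev _) => apply: PF_rev
  | |- PF (fun _ => map _ _) => apply: PF_map
  | |- PF (fun _ => cat _ _) => apply: PF_cat
  | |- PF (fun _ => flatten _) => apply: PF_flatten
  | |- PF (fun _ => filter _ _) => apply: PF_filter
  | |- PF (fun _ => has _ _) => apply: PF_has
  | |- PF (fun _ => all _ _) => apply: PF_all
  | |- PF (fun _ => count _ _) => apply: PF_count
  | |- PF (fun _ => size _) => apply: PF_size
  | |- PF (fun _ => nseq _ _) => apply: PF_nseq
  | |- PF (fun _ => drop _ _) => apply: PF_drop
  | |- PF (fun _ => S _) => apply: PF_succ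
  | |- PF (fun _ => addn _ _) => apply: PF_addn
  | |- PF (fun _ => subn _ _) => apply: PF_subn
  | |- PF (fun _ => muln _ _) => apply: PF_muln
  | |- PF (fun _ => leq _ _) => apply: PF_leq
  | |- PF (fun _ => @eq_op _ _ _) => first [apply: PF_eqn | apply: PF_eqb | pf_user]
  | |- PF (fun _ => iota 0 _) => apply: PF_iota
  | |- _ => pf_user
  end.

Ltac pf := repeat (pf1; cbv beta).

(** * From stack machines to Turing machines *)

Section TapesAsStacks.
Variable G : Type.
Implicit Types (s : seq G) (r : seq (option G)).

(** The top of the stack is under the head and the rest to its right. Cells left of the head may
    hold anything, as a push overwrites the cell it moves to. *)
Definition stack_tape s r := exists m, r = map Some s ++ nseq m None.

Lemma stack_tape_read s r : stack_tape s r -> head None r = ohead s.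
Proof. by case=> m ->; case: s => //; case: m. Qed.

Lemma stack_tape_pop s r : stack_tape s r -> stack_tape (behead s) (behead r).
Proof. by case=> m ->; case: s => [|x s]; [exists m.-1;
  case: m | exists m]. Qed.

Lemma stack_tape_stay s r :
  stack_tape s r -> stack_tape s (head None r :: behead r).
Proof.
by case=> m ->; case: s => [|x s]; [case: m => [|m];
  [exists 1|exists m.+1]|exists m].
Qed.

End TapesAsStacks.

Section MachineOfFragment.
Variables (A B : finType) (F : frag (A + B)%type).
Local Notation Z := (A + B)%type.
Local Notation sy := (sg Z).

Definition in_sym (a : A) : sy := inr (inl a).
Definition out_sym (b : B) : sy := inr (inr b).

Lemma in_sym_inj : injective in_sym. Proof. by move=> a a' []. Qed.
Lemma out_sym_inj : injective out_sym. Proof. by move=> b b' []. Qed.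

Definition tape_of (i : ix) : 'I_3 :=
  match i with I0 => ord0 | I1 => Ordinal (isT : 1 < 3) | I2 => ord_max end.

Lemma tape_of_inj : injective tape_of.
Proof. by case; case. Qed.

(* The second component is a symbol that remains to be written: a push takes two
   steps, one to move left and one to write. *)
Definition frag_state : finType :=
  (option (fstate F) * option ('I_3 * sy))%type.

Definition acts_on (j : 'I_3) (a : option sy * move)
    (o : {ffun 'I_3 -> option sy}) : {ffun 'I_3 -> option sy * move} :=
  [ffun i => if i == j then a else (o i, Stay)].

Definition frag_delta (q : frag_state) (o : {ffun 'I_3 -> option sy}) :
    frag_state * {ffun 'I_3 -> option sy * move} :=
  match q with
  | (q, Some (j, x)) => ((q, None), acts_on j (Some x, Stay) o)
  | (None, None) => ((None, None), acts_on ord0 (o ord0, Stay) o)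
  | (Some q, None) =>
    let d := fdelta q (fun i => o (tape_of i)) in
    match d.2 with
    | None => ((d.1, None), acts_on ord0 (o ord0, Stay) o)
    | Some (i, None) => ((d.1, None), acts_on (tape_of i) (None, MoveRight) o)
    | Some (i, Some x) => ((d.1, Some (tape_of i, x)),
                           acts_on (tape_of i) (o (tape_of i), MoveLeft) o)
    end
  end.

Definition frag_tm : tm A B :=
  @TM A B 2 frag_state sy _ in_sym_inj _ out_sym_inj
    (Some (finit F), None) (pred1 (None, None)) frag_delta.

Definition represents (s : stk (A + B)%type) (T : {ffun 'I_3 -> tape sy}) :=
  forall i, stack_tape (get s i) (T (tape_of i)).2.

Lemma represents_tops s T : represents s T ->
  (fun i => [ffun j => tape_read (T j)] (tape_of i)) = tops s.
Proof.
move=> sT; apply: functional_extensionality => i; rewrite ffunE.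
exact: stack_tape_read.
Qed.

Lemma acts_on_eq i a o : acts_on (tape_of i) a o (tape_of i) = a.
Proof. by rewrite ffunE eqxx. Qed.

Lemma acts_on_neq i i' a o : i' <> i ->
  acts_on (tape_of i) a o (tape_of i') = (o (tape_of i'), Stay).
Proof. by move=> ne; rewrite ffunE; case: eqP => // /tape_of_inj. Qed.

Lemma get_upd (s : stk Z) i v : get (upd s i v) i = v.
Proof. by case: i. Qed.

Lemma get_upd_neq (s : stk Z) i i' v : i' <> i -> get (upd s i v) i' = get s i'.
Proof. by case: i i' => [] []. Qed.

Lemma ix_eq (i i' : ix) : i' = i \/ i' <> i.
Proof. by case: i; case: i'; (try by left); right. Qed.

Lemma frag_tm_step q s T : represents s T ->
  exists n T', [/\ n <= 2,
    iter n (tm_step (M := frag_tm)) ((Some q, None), T) =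
      (((fdelta q (tops s)).1, None), T') &
    represents (do_action (fdelta q (tops s)).2 s) T'].
Proof.
move=> sT; have stay i : stack_tape (get s i)
    (tape_act ([ffun j => tape_read (T j)] (tape_of i),
      Stay) (T (tape_of i))).2.
  by rewrite ffunE; apply: stack_tape_stay.
have step : tm_step (M := frag_tm) ((Some q, None), T) =
  let o := [ffun j => tape_read (T j)] in
  let d := frag_delta (Some q, None) o in
  (d.1, [ffun j => tape_act (d.2 j) (T j)]) by [].
move: step; rewrite /= (represents_tops sT).
case: (fdelta q (tops s)) => p [[i [x|]]|] /= step.
- exists 2; eexists; split=> //.
    rewrite [iter _ _ _]/= step /tm_step /=.
    have -> : ((p, Some (tape_of i, x)) == (None, None) :> frag_state) = false.
      by case: (p).
    case: (p) => [p'|] /=; reflexivity.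
  move=> i'; case: (ix_eq i i') => [->|ne].
    have [m /= e] := stay i; rewrite ffunE acts_on_eq get_upd /= ffunE acts_on_eq /=.
    by exists m; rewrite e.
  rewrite ffunE acts_on_neq // get_upd_neq // [X in tape_act (X, _) _]ffunE.
  by apply: stack_tape_stay; rewrite ffunE acts_on_neq.
- exists 1; eexists; split; [by []|rewrite [iter _ _ _]/= step; reflexivity|].
  move=> i'; case: (ix_eq i i') => [->|ne]; rewrite ffunE.
    by rewrite acts_on_eq get_upd; apply: stack_tape_pop.
  by rewrite acts_on_neq // get_upd_neq.
- exists 1; eexists; split; [by []|rewrite [iter _ _ _]/= step; reflexivity|].
  move=> i; rewrite ffunE; case: (ix_eq I0 i) => [->|ne].
    by rewrite (acts_on_eq I0).
  by rewrite (acts_on_neq _ _ ne).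
Qed.

Lemma frag_tm_run q s t s' T : run_from q s t s' -> represents s T ->
  exists n T', [/\ n <= t.*2,
    iter n (tm_step (M := frag_tm)) ((q, None), T) = ((None, None), T') &
    represents s' T'].
Proof.
move=> r; elim: r T => {q s t s'} [s|q s t s' _ IH] T sT; first by exists 0, T.
have [n [T1 [le_n it1 /IH[m [T2 [le_m it2 sT2]]]]]] := frag_tm_step q sT.
exists (m + n), T2; split=> //; first by rewrite doubleS; lia.
by rewrite iterD it1.
Qed.

Lemma frag_tm_outputs t (w : seq A) (v : seq B) s0 s1 :
  runs F (map in_sym w, [::], [::]) t (s0, s1, map out_sym v) ->
  forall u, t.*2 <= u -> tm_outputs_in frag_tm u w v.
Proof.
case=> t' le_t' r u le_u.
have [|n [T [le_n it sT]]] := frag_tm_run r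
    (T := (tm_start frag_tm w).2).
  move=> i; rewrite ffunE; case: i => /=; last by exists 0.
    by exists 0; rewrite cats0 -map_comp.
  by exists 0.
have {}it : iter n (tm_step (M := frag_tm)) (tm_start frag_tm w) =
    ((None, None), T) by [].
have le_nu : n <= u.
  by apply: leq_trans le_n (leq_trans _ le_u); rewrite leq_double.
have {}it : iter u (tm_step (M := frag_tm)) (tm_start frag_tm w) =
    ((None, None), T).
  by rewrite -(subnK le_nu) iterD it; elim: (u - n) => //= m ->.
rewrite /tm_outputs_in it; split=> //.
by have [m e] := sT I2; exists m; rewrite [LHS]e -map_comp.
Qed.

End MachineOfFragment.

(** * Reading the input and writing the output *)

Section PolytimeOfPF.
Variables A B : finType.
Local Notation Z := (A + B)%type.
Local Notation sy := (sg Z).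

Definition on_symbol (T : finType) (sym : T -> sy) (F : T -> frag Z) : frag Z :=
  foldr (fun x G => ifte (fun o => o I0 == Some (sym x)) (F x) G) skip (enum T).

(** The code of a list is the concatenation of these blocks followed by one [false], so it can be
    produced letter by letter. *)
Definition code_item (a : A) : seq sy := bit Z true :: tws Z a.

Definition read_input : frag Z :=
  fseq (whil (fun o => o I0 != None)
     (fseq (on_symbol (@in_sym A B) (fun a => push_word I1 (rev (code_item a))))
        (pop I0)))
  (fseq (push I1 (bit Z false))
    (whil (fun o => o I1 != None) (fseq (copy I1 I0) (pop I1)))).

Lemma sz_fin (D : finType) (d : D) : sz d <= #|D|.*2.
Proof.
rewrite (_ : sz d = (enum_rank d).*2.+1).
  by rewrite ltn_double.
by rewrite /sz /=; elim: (nat_of_ord _) => // n; rewrite doubleS /= => ->.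
Qed.

Lemma runs_on_symbol (T : finType) (sym : T -> sy) F s t s' x :
  injective sym -> ohead s.1.1 = Some (sym x) ->
  runs (F x) s t s' -> runs (on_symbol sym F) s (#|T| + t) s'.
Proof.
move=> sym_inj hs r; rewrite /on_symbol cardE.
have: x \in enum T by rewrite mem_enum.
elim: (enum T) => // y e IH; rewrite inE;
  case: (eqVneq x y) => [<- _|ne /IH r'] /=.
  rewrite addSn; apply: runs_ifte; rewrite /tops hs eqxx.
  by apply: runsW r _; apply: leq_addl.
by rewrite addSn; apply: runs_ifte;
  rewrite /tops hs (inj_eq (@Some_inj _)) inj_eq ?(negPf ne).
Qed.

Lemma runs_on_symbol_skip (T : finType) (sym : T -> sy) F s :
  (forall x, ohead s.1.1 != Some (sym x)) ->
  runs (on_symbol sym F) s #|T|.+1 s.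
Proof.
move=> hs; rewrite /on_symbol cardE.
elim: (enum T) => [|y e IH] /=; first exact: runs_prim.
by apply: runs_ifte; rewrite /tops (negPf (hs y)).
Qed.

Lemma runs_read_input : exists2 T, pbound T & forall w : seq A,
  runs read_input (map (@in_sym A B) w, [::], [::]) (T (size w))
    (tws Z w, [::], [::]).
Proof.
pose g (u : seq sy) (x : sy) :=
  if x is inr (inl a) then rev (code_item a) ++ u else u.
pose k := (#|A| + (#|A|.*2 + 1 + 1)) + 1.
have g_in w u : foldl g u (map (@in_sym A B) w) =
    rev (flatten (map code_item w)) ++ u.
  by elim: w u => //= a w IH u; rewrite IH catA -rev_cat.
have tws_w (w : seq A) : tws Z w = flatten (map code_item w) ++ [:: bit Z false].
  elim: w => // a w IH; rewrite /tws /tw /= map_cat; congr cons.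
  by rewrite -catA; congr cat.
pose m := #|A|.*2.+1.
have sz_item a : size (code_item a) <= m.
  by rewrite /= size_tw ltnS sz_fin.
exists (fun n => ((#|A| + (m + 1) + 1).+1 * n + 1) + (1 + (3 * (m * n + 1) + 1))).
  by auto 20.
move=> w.
have sz_w : size (tws Z w) <= m * size w + 1.
  rewrite tws_w size_cat leq_add2r; elim: w => // a w IH.
  suff: size (code_item a ++ flatten (map code_item w)) <= m * (size w).+1 by [].
  by rewrite size_cat mulnS leq_add.
have := @runs_each _ _ (fun u v => (v, u, [::])) g I0 None
  (fseq (on_symbol (@in_sym A B) (fun a => push_word I1 (rev (code_item a))))
        (pop I0)) (#|A| + (m + 1) + 1) [::] (map (@in_sym A B) w).
rewrite g_in cats0 size_map => r1.
have := @runs_each _ _ (fun u v => (u, v, [::])) (fun u x => x :: u) I1 None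
  (fseq (copy I1 I0) (pop I1)) 2 [::] (rev (tws Z w)).
rewrite foldl_cons revK cats0 size_rev => r2.
apply: runs_seq (r1 _ _ _) _.
- by rewrite -map_comp; apply/mapP => -[].
- by move=> u [|x v].
- move=> u x v.
  apply: (@runs_seq _ _ _ _ _ (x :: v, g u x, [::]) _ _ _ (runs_prim _ _)).
  case: x => [b|[a|b]] /=.
  + apply: runsW (runs_on_symbol_skip _ _) _ => //; lia.
  + apply: (runs_on_symbol (x := a)) => //; first exact: in_sym_inj.
    apply: runsW (runs_push_word I1 _ _) _.
    by rewrite size_rev leq_add2r.
  + apply: runsW (runs_on_symbol_skip _ _) _ => //; lia.
apply: (runs_seq (runs_prim _ _)); rewrite /=.
have -> : bit Z false :: rev (flatten (map code_item w)) = rev (tws Z w).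
  by rewrite tws_w rev_cat.
apply: runsW (r2 _ _ _) _.
- by apply/mapP => -[].
- by move=> u [|x v].
- by move=> u x v; apply: (runs_seq (runs_prim _ _) (runs_prim _ _)).
- by rewrite leq_add2r leq_mul2l.
Qed.

(** Decodes the rank of a letter, written in unary: each pair [true], [false] on stack 0 skips a
    letter of [e], and the final [false] selects the current one. *)
Fixpoint read_out (e : seq B) : frag Z :=
  if e is b :: e' then
    ifte (fun o => o I0 == Some (bit Z false))
      (fseq (pop I0) (push I1 (@out_sym A B b)))
      (fseq (pop I0) (fseq (pop I0) (read_out e')))
  else skip.

Definition write_output : frag Z :=
  fseq (whil (fun o => o I0 == Some (bit Z true)) (fseq (pop I0) (read_out (enum B))))
    (whil (fun o => o I1 != None) (fseq (copy I1 I2) (pop I1))).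

Lemma runs_read_out b0 (e : seq B) n s0 s1 : n < size e ->
  runs (read_out e) (tw Z (enc_nat n) ++ s0, s1, [::]) (3 * size e)
    (s0, @out_sym A B (nth b0 e n) :: s1, [::]).
Proof.
elim: e n => // b e IH [|n] lt_n /=.
  apply: (@runsW _ _ _ 3); last by rewrite mulnS leq_addr.
  apply: runs_ifte; rewrite {1}/tops /=.
  exact: (runs_seq (runs_prim _ _) (runs_prim _ _)).
rewrite mulnS; apply: (@runs_ifte _ _ _ _ _ (1 + (1 + 3 * size e))).
rewrite {1}/tops /=; do 2 apply: (runs_seq (runs_prim _ _)).
exact: IH.
Qed.

Lemma runs_write_output (v : seq B) :
  runs write_output (tws Z v, [::], [::]) ((2 + 3 * #|B|) * size v + 1 + (3 * size v + 1))
    (tws Z ([::] : seq B), [::], map (@out_sym A B) v).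
Proof.
have r1 u : runs (whil (fun o => o I0 == Some (bit Z true))
     (fseq (pop I0) (read_out (enum B))))
    (tws Z v, u, [::]) ((2 + 3 * #|B|) * size v + 1)
    (tws Z ([::] : seq B), catrev (map (@out_sym A B) v) u, [::]).
  elim: v u => [|b v IH] u; first by rewrite muln0; apply: runs_whil_exit.
  rewrite [size _]/= mulnS -addnA.
  rewrite [2 + _]addSn addSn; apply: (runs_whil_step _ _ (IH _)) => //.
  apply: (@runs_seq _ _ _ _ 1) (runs_prim _ _) _.
  rewrite cardE /= map_cat -/(tw Z _) -[map _ (code _)]/(tws Z v).
  have := @runs_read_out b (enum B) (enum_rank b) (tws Z v) u.
  rewrite nth_enum_rank; apply.
  by rewrite -cardE.
have := @runs_each _ _ (fun u v' => (tws Z ([::] : seq B), v', u))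
  (fun u x => x :: u) I1 None (fseq (copy I1 I2) (pop I1)) 2 [::]
  (rev (map (@out_sym A B) v)).
rewrite foldl_cons revK cats0 size_rev size_map => r2.
apply: runs_seq (r1 _) _; rewrite catrevE cats0; apply: r2.
- by apply/mapP => -[].
- by move=> u [|x v'].
- by move=> u x v'; apply: (runs_seq (runs_prim _ _) (runs_prim _ _)).
Qed.

Lemma polytime_of_PF (f : seq A -> seq B) : PF f -> polytime f.
Proof.
move=> Pf; have [l szf] := sz_PF Pf; have [F [k rF]] := Pf Z.
have [T pT rT] := runs_read_input.
pose m := #|A|.*2.+1.
have sz_w (w : seq A) : sz w <= m * size w + 1.
  elim: w => [|a w IH]; first by rewrite addn1.
  rewrite sz_cons /= mulnS.
  by have := sz_fin a; rewrite /m in IH *; lia.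
pose t n := T n + ((m * n + 1).+2 ^ k +
  ((2 + 3 * #|B|) * (m * n + 1).+2 ^ l + 1 + (3 * (m * n + 1).+2 ^ l + 1))).
have pb e : pbound (fun n => (m * n + 1).+2 ^ e) by auto 10.
have [j tj] : pbound (fun n => (t n).*2).
  apply: (@pbound_le _ (fun n => 2 * t n)) => [n|]; first by rewrite mul2n.
  by rewrite /t; auto 20.
exists (frag_tm (fseq read_input (fseq F write_output))), (('X + 2%:R) ^+ j)%R.
move=> w; rewrite (_ : _.[_]%R = (size w).+2 ^ j); last first.
  by rewrite horner_exp hornerD hornerX -polyC_natr hornerC !natrE addn2.
apply: (@frag_tm_outputs _ _ _ (t (size w))) (tj _).
  apply: runs_seq (rT _) _.
  have := rF w [::] [::]; rewrite !cats0 => r.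
  apply: runs_seq (runsW r _) _; first by apply: leq_expl; rewrite !ltnS.
  apply: runsW (runs_write_output _) _.
  have sz_fw : size (f w) <= (m * size w + 1).+2 ^ l.
    apply: leq_trans (ltnW (size_sz _)) _.
    apply: leq_trans (leq_trans (leqW (leqW (leqnn _))) (szf w)) _.
    by apply: leq_expl; rewrite !ltnS.
  by rewrite !leq_add // leq_mul2l sz_fw orbT.
Qed.

End PolytimeOfPF.

(** * From binary constraints to b-colorings *)

(** A color-dominating vertex sees [r] colors and so lies in [B]. The [r] classes need [r] such
    vertices, and [#|B| <= r] leaves no slack. *)
Lemma CDV_forced (T : finType) (e : rel T) (B : {set T}) r
    (c : {ffun T -> 'I_r}) :
  #|B| <= r -> (forall v, v \notin B -> #|closed_nbhd e v| < r) ->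
  used_colors c = [set: 'I_r] ->
  (forall i, exists2 v, c v = i & v \in CDV e c) ->
  {in B &, injective c} /\ B \subset CDV e c.
Proof.
move=> le_B small used hasCDV.
have CDV_B v : v \in CDV e c -> v \in B.
  apply: contraLR => /small lt_v; rewrite inE used;
    apply/negP=> /subset_leq_card.
  rewrite cardsT card_ord leqNgt; apply/negP; rewrite negbK.
  exact: leq_ltn_trans (leq_imset_card _ _) lt_v.
have img : c @: (B :&: CDV e c) = [set: 'I_r].
  apply/setP=> i; rewrite inE; apply/imsetP; have [v <- vC] := hasCDV i.
  by exists v; rewrite // inE vC CDV_B.
have eqB : B :&: CDV e c = B.
  apply/eqP; rewrite eqEcard subsetIl (leq_trans le_B) //.
  by rewrite -[X in X <= _](card_ord r) -cardsT -img leq_imset_card.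
split; last by rewrite -eqB subsetIr.
apply/imset_injP; rewrite -eqB img cardsT card_ord eqn_leq eqB le_B andbT.
by rewrite -[X in X <= _](card_ord r) -cardsT -img eqB leq_imset_card.
Qed.

Section NthGraph.
Variables (vT : eqType) (v0 : vT) (V : seq vT).

Lemma card_nth (p : pred vT) :
  #|[set i : 'I_(size V) | p (nth v0 V i)]| = count p V.
Proof. by rewrite cardsE -sum1_card -sum1_count (big_nth v0) big_mkord. Qed.

Lemma map_enum_nth (T : Type) (f : vT -> T) :
  [seq f (nth v0 V i) | i : 'I_(size V)] = map f V.
Proof.
rewrite /image_mem -[enum _]/(enum 'I_(size V)).
rewrite (map_comp (fun i => f (nth v0 V i)) val) val_enum_ord.
by rewrite (map_comp f (nth v0 V)) map_nth_iota0 // take_size.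
Qed.

End NthGraph.

Section ConstraintGraph.
(* Binary constraint satisfaction: each [g \in G] is to be given a value in [W]
   such that no two of the chosen pairs are in conflict. *)
Variables (gT wT : eqType) (G : seq gT) (W : seq wT) (confl : rel (gT * wT)).
Variables (g0 : gT) (w0 : wT).

Definition csp_solvable : Prop := exists ch : gT -> wT,
  (forall g, g \in G -> ch g \in W) /\
  forall g h, g \in G -> h \in G -> g != h ->
    ~~ confl (g, ch g) (h, ch h).

(* The vertices (0, (g, w0)), (2, (g, w)) and (4, _) form a clique but for the
   edges between kinds 0 and 4; they are the only vertices with enough neighbors
   to be color-dominating.  The token (3, (g, w)) is adjacent to (0, (g, w0)),
   which must see the color of (4, _) on one of its tokens: the values of these
   tokens solve the constraints.  The vertex (1, (g, w0)) shows the color of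
   (0, (g, w0)) to (4, _). *)
Local Notation vertex := (nat * (gT * wT))%type.

Definition pairs : seq (gT * wT) := [seq (g, w) | g <- G, w <- W].

(** The vertices of kind 2 provide a private color for every token that is not chosen, and they
    raise the number of hubs above the closed neighborhood of a token, however many conflicts it
    has. *)
Definition layer (i : nat) : seq (gT * wT) :=
  if i <= 1 then [seq (g, w0) | g <- G]
  else if i == 4 then [:: (g0, w0)] else pairs.

Definition layers (ks : seq nat) : seq vertex :=
  [seq (i, x) | i <- ks, x <- layer i].

Definition hubs : seq vertex := layers [:: 0; 2; 4].

Definition vertices : seq vertex := layers [:: 0; 2; 4; 1; 3].

Definition token_edge (a b : vertex) : bool :=
  (a.1 == 3) && (b.1 == 0) && (a.2.1 == b.2.1) || (a.1 == 1) && (b.1 == 4).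

Definition adj (a b : vertex) : bool :=
  if ~~ odd a.1 && ~~ odd b.1 then
    (a != b) && ~~ ((a.1 == 0) && (b.1 == 4) || (a.1 == 4) && (b.1 == 0))
  else if (a.1 == 3) && (b.1 == 3) then
    (a.2.1 != b.2.1) && (confl a.2 b.2 || confl b.2 a.2)
  else token_edge a b || token_edge b a.

Lemma adj_sym : symmetric adj.
Proof.
move=> a b; rewrite /adj andbC [a == b]eq_sym [(a.1 == 3) && _]andbC.
by rewrite [a.2.1 == _]eq_sym [confl a.2 _ || _]orbC [token_edge a b || _]orbC
  [(a.1 == 0) && _ || _]orbC ![(b.1 == _) && (a.1 == _)]andbC.
Qed.

Lemma adj_irr : irreflexive adj.
Proof.
move=> [[|[|[|[|[|n]]]]] x]; rewrite /adj /token_edge /= ?eqxx //=.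
by case: (odd n) => //=; rewrite eqxx.
Qed.

Hypotheses (uG : uniq G) (uW : uniq W) (G_gt0 : 0 < size G) (W_gt0 : 0 < size W).

Lemma mem_layers ks a : (a \in layers ks) = (a.1 \in ks) && (a.2 \in layer a.1).
Proof.
apply/allpairsPdep/andP => [[i [x [ik xi ->]]] //|[ik xi]].
by exists a.1, a.2; split=> //; case: a {ik xi}.
Qed.

Lemma vertices_cat : vertices = hubs ++ layers [:: 1; 3].
Proof. by rewrite /vertices /hubs /layers /= -!catA. Qed.

Lemma hubsE a : (a \in hubs) = (a \in vertices) && ~~ odd a.1.
Proof.
rewrite !mem_layers !inE; case: a => -[|[|[|[|[|n]]]]] x //=;
  rewrite ?andbT ?andbF //.
Qed.

Lemma mem_pairs x : (x \in pairs) = (x.1 \in G) && (x.2 \in W).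
Proof.
apply/allpairsP/andP => [[[g w] [gG wW ->]] //|[xG xW]].
by exists x; split=> //; case: x {xG xW}.
Qed.

Lemma uniq_pairs : uniq pairs.
Proof. by apply: allpairs_uniq => // -[? ?] [? ?]. Qed.

Lemma uniq_layers ks : uniq ks -> uniq (layers ks).
Proof.
move=> uks; apply: allpairs_uniq_dep => // [i _|[? ?] [? ?] _ _ //= [-> ->] //].
rewrite /layer; case: ifP => _; first by rewrite map_inj_uniq // => x y [].
by case: ifP => // _; apply: uniq_pairs.
Qed.

Lemma count_kind j ks :
  count (fun a : vertex => a.1 == j) (layers ks) = count_mem j ks * size (layer j).
Proof.
elim: ks => [|i ks IH] //; rewrite /layers /= count_cat -/(layers ks) IH mulnDl.
congr (_ + _); rewrite count_map; case: (eqVneq i j) => [<-|ne] /=.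
  by rewrite mul1n (eq_count (a2 := predT)) ?count_predT // => x;
    rewrite /= eqxx.
by rewrite mul0n (eq_count (a2 := pred0)) ?count_pred0 // => x /=; apply/negbTE.
Qed.

Let V := vertices.
Let v0 : vertex := (4, (g0, w0)).
Let e : rel 'I_(size V) := fun i j => adj (nth v0 V i) (nth v0 V j).
Let k := size hubs.

Lemma size_hubs : k = (size G + size pairs).+1.
Proof. by rewrite /k /hubs /layers /= !size_cat !size_map /= addn1 addnS. Qed.

Lemma nth_vertices_inj : injective (fun i : 'I_(size V) => nth v0 V i).
Proof.
move=> i j /eqP; rewrite nth_uniq ?uniq_layers //; last by move/eqP/val_inj.
Qed.

Lemma vertex_index a : a \in V -> exists i : 'I_(size V), nth v0 V i = a.
Proof.
by move=> aV; exists (Ordinal (etrans (index_mem _ _) aV));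
  rewrite /= nth_index.
Qed.

Lemma nth_in (i : 'I_(size V)) : nth v0 V i \in V.
Proof. exact: mem_nth. Qed.

Lemma graph_sym : symmetric e.
Proof. by move=> i j; rewrite /e adj_sym. Qed.

Lemma graph_irr : irreflexive e.
Proof. by move=> i; rewrite /e adj_irr. Qed.

(** A vertex of kind 1 sees itself and one hub. A token sees at most all tokens and the hub of its
    cell, [1 + size pairs] vertices; [k] is larger by [size G]. *)
Lemma small_nbhd (i : 'I_(size V)) : odd (nth v0 V i).1 ->
  #|closed_nbhd e i| < k.
Proof.
set a := nth v0 V i => odd_a.
have -> : closed_nbhd e i = [set j : 'I_(size V) | (nth v0 V j == a) || adj a (nth v0 V j)].
  by apply/setP => j; rewrite !inE (inj_eq nth_vertices_inj).
rewrite (@card_nth _ v0 V (fun b => (b == a) || adj a b)).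
have pairs_gt0 : 0 < size pairs by rewrite size_allpairs muln_gt0 G_gt0.
have uV : uniq V by rewrite uniq_layers.
have count1 b : count_mem b V <= 1 by rewrite count_uniq_mem // leq_b1.
have countU (p q : pred vertex) m n : count p V <= m -> count q V <= n ->
    count (predU p q) V <= m + n.
  move=> pm qn; apply: leq_trans (leq_add pm qn).
  by rewrite -count_predUI leq_addr.
have kind_a : (a.1 == 1) || (a.1 == 3).
  have := nth_in i; rewrite -/a mem_layers => /andP[+ _]; rewrite !inE.
  by case: (a.1) odd_a => [|[|[|[|[|]]]]].
case/orP: kind_a => /eqP kind_a.
  apply: (@leq_ltn_trans 2); last by rewrite size_hubs; lia.
  apply: leq_trans (countU (pred1 a) (fun b => b.1 == 4) 1 1 _ _) => //.
    apply: sub_count => b /= /orP[->//|]; rewrite /adj /token_edge kind_a /=.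
    by case/orP => [-> | ]; [rewrite orbT | rewrite !andbF].
  by rewrite count_kind.
apply: (@leq_ltn_trans (1 + size pairs)); last by rewrite size_hubs; lia.
apply: leq_trans (countU (pred1 (0, (a.2.1, w0))) (fun b =>
  b.1 == 3) 1 _ _ _) => //;
  last by rewrite count_kind /= mul1n.
rewrite (eq_in_count (a2 := predI (mem V) (fun b => (b == a) || adj a b))).
  apply: sub_count => -[i' [g w]] /= /andP[]; rewrite mem_layers /=.
  case: i' => [|[|[|[|[|i']]]]] //=; rewrite ?orbT //.
  - case/mapP => g' _ [-> ->]; rewrite orbF.
    rewrite /adj /token_edge kind_a /= ?andbT ?orbF.
    by case/orP => [/eqP e0|/eqP ->] //; rewrite -e0 in kind_a.
  - move=> _; rewrite /adj /token_edge kind_a /= ?andbF ?orbF => /eqP e1.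
    by rewrite -e1 in kind_a.
  - move=> _; rewrite /adj /token_edge kind_a /= ?andbF ?orbF => /eqP e1.
    by rewrite -e1 in kind_a.
  - move=> _; rewrite /adj /token_edge kind_a /= ?andbF ?orbF => /eqP e1.
    by rewrite -e1 in kind_a.
by move=> b bV; rewrite /= bV.
Qed.

(** A hub of kind 2 is adjacent to all other hubs, and every vertex that is not a hub has a hub as
    neighbor. *)
Lemma graph_connected : connected_graph e.
Proof.
have [g [g' eG]] : exists g g', G = g :: g'.
  by case: G G_gt0 => // g s _; exists g, s.
have [w [w' eW]] : exists w w', W = w :: w'.
  by case: W W_gt0 => // w s _; exists w, s.
have vG h : h \in G -> (0, (h, w0)) \in V.
  by move=> hG; rewrite mem_layers /=; apply/mapP; exists h.
have v4 : (4, (g0, w0)) \in V by rewrite mem_layers /= inE.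
have [u eu] : exists u : 'I_(size V), nth v0 V u = (2, (g, w)).
  by apply: vertex_index; rewrite mem_layers /= mem_pairs eG eW !inE !eqxx.
split; first by rewrite card_ord (leq_ltn_trans _ (ltn_ord u)).
suff con (i : 'I_(size V)) : connect e i u.
  move=> i j; apply: connect_trans (con i) _.
  by rewrite (sym_connect_sym graph_sym).
have even_con (j : 'I_(size V)) : ~~ odd (nth v0 V j).1 -> connect e j u.
  move=> ev; case: (eqVneq j u) => [->|ne]; first exact: connect0.
  apply: connect1; rewrite /e eu /adj /= ev /= !andbF /= andbT -eu.
  by rewrite (inj_eq nth_vertices_inj).
have [/even_con //|odd_i] := boolP (~~ odd (nth v0 V i).1).
have := nth_in i; rewrite negbK in odd_i; case ei: (nth v0 V i) odd_i => [i' x].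
rewrite mem_layers /=; case: i' ei => [|[|[|[|[|i']]]]] //= ei _ Lx.
  have [j ej] := vertex_index v4; apply: connect_trans (even_con j _).
    by apply: connect1; rewrite /e ei ej.
  by rewrite ej.
have [|j ej] := @vertex_index (0, (x.1, w0)).
  by apply: vG; move: Lx; rewrite mem_pairs => /andP[].
apply: connect_trans (even_con j _); last by rewrite ej.
by apply: connect1; rewrite /e ei ej /adj /token_edge /= eqxx.
Qed.

Lemma solvable_of_coloring r :
  realizes e (fun=> 1) r -> k <= r -> csp_solvable.
Proof.
case/existsP => c /and3P[/andP[/forallP proper _] /eqP used /forallP s1] le_kr.
pose B := [set i : 'I_(size V) | ~~ odd (nth v0 V i).1].
have cardB : #|B| = k.
  rewrite (@card_nth _ v0 V (fun a => ~~ odd a.1)) /V vertices_cat count_cat.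
  rewrite (eq_in_count (a2 := predT)) => [|a]; last by rewrite hubsE => /andP[].
  rewrite count_predT (eq_in_count (a2 := pred0)) ?count_pred0 ?addn0 // => a.
  by rewrite mem_layers !inE; case: a => -[|[|[|[|]]]].
have [||//|i|inj_c /subsetP cdv] := @CDV_forced _ e B r c.
- by rewrite cardB.
- by move=> i; rewrite inE negbK => /small_nbhd lt_k;
    apply: leq_trans lt_k le_kr.
- have := s1 i; rewrite card_gt0 => /set0Pn[v]; rewrite inE => /andP[].
  by rewrite inE => /eqP ci vC; exists v.
have [t et] : exists t : 'I_(size V), nth v0 V t = (4, (g0, w0)).
  by apply: vertex_index; rewrite mem_layers /= inE.
have tB : t \in B by rewrite inE et.
have wit g : g \in G -> exists2 w, w \in W & exists i : 'I_(size V),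
    nth v0 V i = (3, (g, w)) /\ c i = c t.
  move=> gG; have [l el] : exists l : 'I_(size V), nth v0 V l = (0, (g, w0)).
    by apply: vertex_index; rewrite mem_layers /=; apply/mapP; exists g.
  have lB : l \in B by rewrite inE el.
  have := cdv l lB; rewrite inE used => /subsetP/(_ (c t) (in_setT _)).
  (* Colors are distinct on hubs and [l] is not adjacent to [t], so the color of [t] is seen outside
     the hubs, where [l] has only the tokens of [g] as neighbors. *)
  case/imsetP => i; rewrite inE => /orP[/eqP -> ct|li ct].
    by have := inj_c _ _ tB lB ct => tl; rewrite -tl et in el.
  have [iB|] := boolP (i \in B).
    by have := inj_c _ _ tB iB ct => ti; rewrite -ti /e el et in li.
  rewrite inE negbK => odd_i; move: li; rewrite /e el /adj /= odd_i /=.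
  have := nth_in i; rewrite mem_layers;
    case ei: (nth v0 V i) odd_i => [i' [g' w]].
  case: i' ei => [|[|[|[|[|i']]]]] //= ei _.
  rewrite mem_pairs /= /token_edge /= => /andP[_ wW]; rewrite orbF => /eqP eg.
  by exists w => //; exists i; rewrite ei eg.
(* The choice has to be a function of [g]: it is the first value whose token has the color of
   [t]. *)
pose P g w := [exists i : 'I_(size V),
  (nth v0 V i == (3, (g, w))) && (c i == c t)].
have chP g : g \in G -> nth w0 W (find (P g) W) \in W /\
    exists i : 'I_(size V), nth v0 V i = (3, (g,
      nth w0 W (find (P g) W))) /\ c i = c t.
  move=> /wit[w wW [i [ei ci]]].
  have hasP : has (P g) W.
    by apply/hasP; exists w => //; apply/existsP; exists i; rewrite ei ci !eqxx.
  split; first by rewrite mem_nth // -has_find.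
  by have /existsP[j /andP[/eqP ej /eqP cj]] := nth_find w0 hasP; exists j.
exists (fun g => nth w0 W (find (P g) W)); split=> [g /chP[] //|g h gG hG ne].
have [_ [i [ei ci]]] := chP g gG; have [_ [j [ej cj]]] := chP h hG.
apply/negP => conf; have /forallP/(_ j) := proper i.
by rewrite ci cj eqxx implybF /e ei ej /adj /= ne conf.
Qed.

Lemma coloring_of_solution : csp_solvable -> realizes e (fun=> 1) k.
Proof.
case=> ch [chW chok].
(* The hub whose color [a] receives. Chosen tokens share the color of the hub of kind 4, which is
   proper because chosen values do not conflict; any other token takes that of its own hub of kind
   2. *)
pose rep (a : vertex) : vertex :=
  if a.1 == 1 then (0, a.2)
  else if a.1 == 3 then
    if a.2.2 == ch a.2.1 then (4, (g0, w0)) else (2, a.2)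
  else a.
have rep_hub a : a \in V -> rep a \in hubs.
  rewrite hubsE !mem_layers; case: a => -[|[|[|[|[|i]]]]] x //=;
    rewrite ?andbT // /rep /=.
  by case: ifP => _ /=; rewrite andbT // inE.
have rep_id a : a \in hubs -> rep a = a.
  by rewrite hubsE mem_layers; case: a => -[|[|[|[|[|i]]]]] x //= /andP[].
have rep_adj a b : a \in V -> b \in V -> adj a b -> rep a != rep b.
  rewrite !mem_layers /adj /rep /token_edge.
  case: a => -[|[|[|[|[|i]]]]] [g w] //=;
    case: b => -[|[|[|[|[|j]]]]] [h x] //=;
    rewrite ?andbT ?andbF ?orbF //=;
    try by (do ?case: ifP).
  rewrite !mem_pairs => /andP[gG _] /andP[hG _] /andP[ne conf].
  case: (w =P ch g) => [ew|_]; case: (x =P ch h) => [ex|_] //; last first.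
    by apply: contraNneq ne => -[-> _].
  have := chok _ _ gG hG ne; have := chok _ _ hG gG.
  by rewrite eq_sym -ew -ex => /(_ ne) /negPf c1 /negPf c2;
    rewrite c1 c2 in conf.
have lt_c (i : 'I_(size V)) : index (rep (nth v0 V i)) hubs < k.
  by rewrite index_mem rep_hub ?nth_in.
pose c := [ffun i => Ordinal (lt_c i)].
have cE i j : (c i == c j) = (rep (nth v0 V i) == rep (nth v0 V j)).
  rewrite -val_eqE !ffunE /=; apply/eqP/eqP => [|-> //].
  by move=> /(congr1 (nth v0 hubs)); rewrite !nth_index ?rep_hub ?nth_in.
have c_surj (q : 'I_k) : exists i : 'I_(size V), nth v0 V i \in hubs /\ c i = q.
  have qV : nth v0 hubs q \in V by have := mem_nth v0 (ltn_ord q);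
    rewrite hubsE => /andP[].
  have [i ei] := vertex_index qV; exists i; rewrite ei mem_nth //; split=> //.
  apply: val_inj; rewrite ffunE /= ei rep_id ?mem_nth // index_uniq //.
  exact: uniq_layers.
have used : used_colors c = setT.
  apply/setP => q; rewrite inE; apply/imsetP.
  by have [i [_ <-]] := c_surj q; exists i.
have cdv (i : 'I_(size V)) : nth v0 V i \in hubs -> i \in CDV e c.
  move=> hi; rewrite inE; apply/subsetP => q _; apply/imsetP.
  have [j [hj <-]] := c_surj q.
  case: (eqVneq i j) => [->|ne]; first by exists j; rewrite // inE eqxx.
  have [eij|neij] := boolP (e i j); first by exists j; rewrite // inE eij orbT.
  (* Distinct nonadjacent hubs have kinds 0 and 4. The missing color is shown to the former by the
     chosen token of its cell and to the latter by a vertex of kind 1. *)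
  suff [l [lV al rl]] : exists l, [/\ l \in V, adj (nth v0 V i) l &
      rep l = rep (nth v0 V j)].
    have [u eu] := vertex_index lV; exists u;
      first by rewrite inE /e eu al orbT.
    by apply/eqP; rewrite eq_sym cE eu rl.
  move: neij; rewrite /e [in adj _ _]/adj.
  move: (hi) (hj); rewrite !hubsE => /andP[iV evi] /andP[jV evj].
  rewrite evi evj /= (inj_eq nth_vertices_inj) ne /= negbK.
  move: iV jV; rewrite !mem_layers.
  case: (nth v0 V i) => i' x; case: (nth v0 V j) => j' y /=.
  move=> /andP[_ Lx] /andP[_ Ly] /orP[]/andP[/eqP ei /eqP ej]; subst i' j'.
    move: Lx Ly; rewrite /= inE => /mapP[g gG ->] /eqP ->.
    exists (3, (g, ch g)); rewrite mem_layers /= mem_pairs /= gG chW //.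
    by rewrite /rep /adj /token_edge /= !eqxx.
  move: Lx Ly => /= Lx Ly; exists (1, y); by rewrite mem_layers.
apply/existsP; exists c; rewrite used eqxx /=; apply/andP; split.
  apply/andP; split; apply/forallP => i.
    apply/forallP => j; apply/implyP => eij; rewrite cE.
    by apply: rep_adj; rewrite ?nth_in.
  have [j [hj cj]] := c_surj i; apply/implyP => _; apply/set0Pn; exists j.
  by rewrite in_setI inE cj eqxx cdv.
apply/forallP => i; rewrite card_gt0.
have [j [hj cj]] := c_surj i; apply/set0Pn; exists j.
by rewrite in_setI inE cj eqxx cdv.
Qed.

Lemma csp_instance : exists2 I : instance,
  encode I = join_words (bits_int k%:Z ::
    [seq [seq adj a b | b <- vertices] | a <- vertices] ++ [:: [::]]) &
  (yes_instance I <-> csp_solvable).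
Proof.
exists (@Instance (fun=> 1) (fun=> isT) (fun _ _ _ => isT) 0 (fun _ _ =>
  erefl) _ e
  (conj graph_sym graph_irr) graph_connected k%:Z).
  congr (join_words (_ :: _ ++ _)).
  rewrite /adj_rows -[in RHS](map_enum_nth v0 V).
  apply: eq_map => i; exact: (map_enum_nth v0 V (adj (nth v0 V i))).
split=> [/phi_geP[r]|sol]; first exact: solvable_of_coloring.
by apply/phi_geP; exists k; [apply: coloring_of_solution|].
Qed.

End ConstraintGraph.

(** * The tableau of a Turing machine *)

Section Tableau.
Variables (A : finType) (M : tm (A + bool)%type bool).
Local Notation sym := (tm_sym M).
Local Notation tapeix := 'I_(tm_tapes M).+1.

(* Column [j] of a configuration: the state and, for each tape, the symbols at
   distance [j] to the left and to the right of the head.  As the tapes move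
   under fixed heads, a column depends only on the neighboring columns and on
   column 0 of the previous configuration. *)
Definition column : finType :=
  (tm_state M * {ffun tapeix -> option sym * option sym})%type.

Definition column_of (c : config M) (j : nat) : column :=
  (c.1, [ffun i => (nth None (c.2 i).1 j, nth None (c.2 i).2 j)]).

(* Columns 0, [j - 1], [j] and [j + 1]. *)
Definition window : finType := (column * column * column * column)%type.
Definition w_zero (w : window) := w.1.1.1.
Definition w_left (w : window) := w.1.1.2.
Definition w_here (w : window) := w.1.2.
Definition w_right (w : window) := w.2.

(** The head stays at index 0 and the tape shifts: after a move to the left the written symbol is at
    index 1 of the right part, after a move to the right at index 0 of the left part. *)
Definition next_symbols (j : nat) (a : option sym * move)
    (l c r : option sym * option sym) : option sym * option sym :=
  match a.2 with
  | MoveLeft => (r.1, if j == 0 then c.1 else if j == 1 then a.1 else l.2)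
  | Stay => (c.1, if j == 0 then a.1 else c.2)
  | MoveRight => (if j == 0 then a.1 else l.1, r.2)
  end.

Definition next_column (j : nat) (w : window) : column :=
  let z := w_zero w in
  if tm_halt z.1 then w_here w else
  let d := tm_delta z.1 [ffun i => (z.2 i).2] in
  (d.1, [ffun i => next_symbols j (d.2 i) ((w_left w).2 i) ((w_here w).2 i)
                     ((w_right w).2 i)]).

Definition window_of (c : config M) (j : nat) : window :=
  (column_of c 0, column_of c j.-1, column_of c j, column_of c j.+1).

Lemma next_column_window c j : next_column j (window_of c j) = column_of (tm_step c) j.
Proof.
rewrite /next_column /tm_step /=; case: ifP => // _.
have -> : [ffun i => ((column_of c 0).2 i).2] = [ffun i => tape_read (c.2 i)].
  by apply/ffunP => i; rewrite !ffunE /= nth0.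
congr (_, _); apply/ffunP => i; rewrite !ffunE /next_symbols /tape_act /=.
case: ((tm_delta _ _).2 i) => s [] /=; case: (c.2 i) => l r /=;
  by case: j => [|[|j]] /=; rewrite ?nth_behead ?nth0.
Qed.

(** Column 0 has no left neighbor, and no conflict ties the left guess of its cells to anything. *)
Lemma next_column0 z l l' c r : next_column 0 (z, l, c, r) = next_column 0 (z,
  l', c, r).
Proof.
by rewrite /next_column /=; case: ifP.
Qed.

Variables (x : seq A) (B T : nat).
(** The right guess in the last column is free, so at time [t] only the columns [j] with
    [j + t <= S] are reliable. As [T <= S], column 0 is reliable to the end, and row 0 covers input
    and certificate. *)
Let S := T + size x + B.

(* What column [j] may hold initially: [Some (Some a)] is the input symbol [a],
   [Some None] a symbol of the certificate or a blank, and [None] a blank. *)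
Definition content : finType := option (option A).

Definition init_kind (j : nat) : content :=
  nth None ([seq Some (Some a) | a <- x] ++ nseq B (Some None)) j.

Definition init_ok (k : content) (w : window) : bool :=
  [&& (w_here w).1 == tm_init M,
      [forall i : tapeix, (((w_here w).2 i).1 == None) &&
         ((i == ord0) || (((w_here w).2 i).2 == None))] &
      let s := ((w_here w).2 ord0).2 in
      match k with
      | Some (Some a) => s == Some (tm_in M (inl a))
      | Some None => if s is None then ((w_right w).2 ord0).2 == None
                     else [exists b : bool, s == Some (tm_in M (inr b))]
      | None => s == None
      end].

Definition accepts (w : window) : bool :=
  ((w_here w).2 ord_max).2 == Some (tm_out M true).

Definition bad (g : nat * nat) (w : window) : bool :=
  [|| (g.2 == 0) && (w_zero w != w_here w),
      (g.1 == 0) && ~~ init_ok (init_kind g.2) w |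
      (g.1 == T) && (g.2 == 0) && ~~ accepts w].

Definition clash (y y' : (nat * nat) * window) : bool :=
  let: ((t, j), w) := y in let: ((t', j'), w') := y' in
  [|| bad (t, j) w,
      (t == t') && (j' == 0) && (w_zero w != w_here w'),
      (t == t') && (j' == j.+1) && ((w_right w != w_here w') || (w_left w' != w_here w)) |
      (t' == t.+1) && (j == j') && (next_column j w != w_here w')].

Definition cells : seq (nat * nat) :=
  [seq (t, j) | t <- iota 0 T.+1, j <- iota 0 S.+1].

Lemma mem_cells t j : ((t, j) \in cells) = (t <= T) && (j <= S).
Proof.
rewrite -[t <= T]ltnS -[j <= S]ltnS;
  apply/allpairsP/andP => [[[t' j'] [tT jS [-> ->]]]|[tT jS]].
  by move: tT jS; rewrite !mem_iota.
by exists (t, j); rewrite !mem_iota.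
Qed.

Hypothesis T_gt0 : 0 < T.
Variable d : seq (A + bool)%type -> bool.
Hypothesis Mout : forall u : seq bool, size u <= B ->
  tm_outputs_in M T (pair_word x u) [:: d (pair_word x u)].

Definition conf (u : seq bool) (t : nat) : config M :=
  iter t (@tm_step _ _ M) (tm_start M (pair_word x u)).

Lemma accepts_conf u w : size u <= B -> w_here w = column_of (conf u T) 0 ->
  accepts w = d (pair_word x u).
Proof.
move=> le_u ew; have [_ [m e]] := Mout le_u.
rewrite /accepts ew /= ffunE /conf e /=.
by rewrite (inj_eq (@Some_inj _)) (inj_eq (@tm_out_inj _ _ M)); case: d.
Qed.

Lemma nth_start u j : size u <= B ->
  nth None [seq Some (tm_in M a) | a <- pair_word x u] j =
  match init_kind j with
  | Some (Some a) => Some (tm_in M (inl a))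
  | Some None => if nth None (map Some u) (j - size x) is Some b
                 then Some (tm_in M (inr b)) else None
  | None => None
  end.
Proof.
move=> le_u; rewrite /init_kind /pair_word map_cat -!map_comp !nth_cat !size_map.
case: ltnP => [lt_j|le_j].
  case: x lt_j => // a0 s lt_j.
  by rewrite (nth_map a0) // (nth_map a0).
rewrite nth_nseq; case: ltnP => [lt_B|le_B]; last first.
  by rewrite nth_default // size_map (leq_trans le_u).
have [lt_u|ge_u] := ltnP (j - size x) (size u).
  by rewrite !(nth_map false).
by rewrite !nth_default ?size_map.
Qed.

Lemma nth_start_None u j :
  nth None [seq Some (tm_in M a) | a <- pair_word x u] j = None ->
  nth None [seq Some (tm_in M a) | a <- pair_word x u] j.+1 = None.
Proof.
move=> nj; rewrite nth_default // size_map; apply: leqW.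
rewrite leqNgt; apply/negP => lt_j; move: nj.
by case: (pair_word x u) lt_j => // a s lt_j; rewrite (nth_map a).
Qed.

Lemma start_ok u j : size u <= B -> init_ok (init_kind j) (window_of (conf u 0) j).
Proof.
move=> le_u; rewrite /init_ok /w_here /w_right /= eqxx /=; apply/andP; split.
  by apply/forallP => i; rewrite !ffunE /=; case: (i == ord0);
    rewrite /= !nth_nil.
rewrite !ffunE /=.
have := nth_start j le_u; have := @nth_start_None u j.
set s := nth _ _ j; set s' := nth _ _ j.+1.
case: (init_kind j) => [[a|]|] s's es; rewrite es //.
case: (nth _ _ (j - size x)) es => [b|] es; first by apply/existsP; exists b.
by rewrite s's.
Qed.

Lemma solvable_of_certificate u : size u <= B -> d (pair_word x u) ->
  csp_solvable cells (enum window) clash.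
Proof.
move=> le_u du; exists (fun g => window_of (conf u g.1) g.2).
split=> [g _|[t j] [t' j'] _ _ _]; first exact: mem_enum.
rewrite /clash; cbv beta iota; rewrite 3!negb_or; apply/and4P; split.
- rewrite /bad /= 2!negb_or; apply/and3P; split.
  + by case: j => //=; rewrite eqxx.
  + by case: t => //=; rewrite negbK; apply: start_ok.
  + by case: eqP => //= ->; case: j => //=; rewrite negbK (@accepts_conf u).
- by case: eqP => //= <-; case: eqP => //= ->; rewrite eqxx.
- by case: eqP => //= <-; case: eqP => //= ->; rewrite !eqxx.
- by case: eqP => //= ->; case: eqP => //= <-; rewrite next_column_window eqxx.
Qed.

Lemma prefix_of_blanks (f : nat -> option bool) n :
  (forall j, f j = None -> f j.+1 = None) ->
  exists2 u : seq bool, size u <= n & forall j, j < n ->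
    f j = nth None (map Some u) j.
Proof.
elim: n f => [|n IH] f fN; first by exists [::].
case f0: (f 0) => [b|]; last first.
  exists [::] => // j _; rewrite nth_nil.
  by elim: j => // j /fN.
have [|u le_u fu] := IH (fun j => f j.+1); first by move=> j; apply: fN.
by exists (b :: u) => // -[|j] //= /fu.
Qed.

Lemma certificate_of_solution :
  csp_solvable cells (enum window) clash ->
  exists2 u : seq bool, size u <= B & d (pair_word x u).
Proof.
case=> ch [_ chok]; pose X t j := w_here (ch (t, j)).
have S_gt0 : 0 < S by rewrite /S; lia.
have okb t j : t <= T -> j <= S -> ~~ bad (t, j) (ch (t, j)).
  (* Conflicts only bind distinct cells, so the condition on the single cell [(t, j)] is extracted
     from its pair with another cell of the row. *)
  move=> tT jS; pose j' := if j == 0 then 1 else 0.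
  have j'S : j' <= S by rewrite /j'; case: ifP.
  have := chok (t, j) (t, j'); rewrite !mem_cells tT jS j'S => /(_ isT isT).
  rewrite /clash; cbv beta iota; rewrite negb_or => h.
  have: (t, j) != (t, j') by rewrite xpair_eqE eqxx /j'; case: j {jS j'S h j'}.
  by case/h/andP.
have okz t j : t <= T -> j <= S -> w_zero (ch (t, j)) = X t 0.
  move=> tT jS; have := okb t j tT jS; rewrite /bad /= negb_or => /andP[+ _].
  case: j jS => [|j] jS /=; first by rewrite negbK => /eqP.
  move=> _; have := chok (t, j.+1) (t, 0).
  have ne : (t, j.+1) != (t, 0) by rewrite xpair_eqE eqxx.
  rewrite !mem_cells tT jS leq0n => /(_ isT isT ne).
  rewrite /clash; cbv beta iota; rewrite 3!negb_or => /and4P[_ + _ _].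
  by rewrite !eqxx /= negbK => /eqP.
have oklr t j : t <= T -> j < S ->
    w_right (ch (t, j)) = X t j.+1 /\ w_left (ch (t, j.+1)) = X t j.
  move=> tT jS; have := chok (t, j) (t, j.+1).
  have ne : (t, j) != (t, j.+1) by rewrite xpair_eqE eqxx /= ltn_eqF.
  rewrite !mem_cells tT jS (ltnW jS) => /(_ isT isT ne).
  rewrite /clash; cbv beta iota; rewrite 3!negb_or => /and4P[_ _ + _].
  by rewrite !eqxx /= negb_or !negbK => /andP[/eqP -> /eqP ->].
have okn t j : t < T -> j <= S -> X t.+1 j = next_column j (ch (t, j)).
  move=> tT jS; have := chok (t, j) (t.+1, j).
  have ne : (t, j) != (t.+1, j) by rewrite xpair_eqE ltn_eqF.
  rewrite !mem_cells tT jS (ltnW tT) => /(_ isT isT ne).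
  rewrite /clash; cbv beta iota; rewrite 3!negb_or => /and4P[_ _ _ +].
  by rewrite !eqxx /= negbK => /eqP.
have init j : j <= S -> init_ok (init_kind j) (ch (0, j)).
  move=> jS; have := okb 0 j (leq0n _) jS; rewrite /bad /= 2!negb_or.
  by case/and3P => _; rewrite negbK.
(* The certificate as row 0 shows it: a nonblank symbol there is the image of a boolean, and
   comparison with the image of [true] recovers it. *)
pose f j := if j < B then
    if ((X 0 (size x + j)).2 ord0).2 is Some y then Some (y == tm_in M (inr true))
    else None else None.
have kindB j : j < B -> init_kind (size x + j) = Some None.
  move=> lt_j; rewrite /init_kind nth_cat size_map ltnNge leq_addr /= addKn.
  by rewrite nth_nseq lt_j.
have [|u le_u fu] := @prefix_of_blanks f B.
  move=> j; rewrite /f; case: ltnP => [jB|]; last by rewrite ltnNge => /leqW ->.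
  case ej: (((X 0 (size x + j)).2 ord0).2) => [y|] // _; case: ifP => // j1B.
  have jS : size x + j < S by rewrite /S; lia.
  have := init _ (ltnW jS); rewrite kindB // => /and3P[_ _].
  rewrite -/(X 0 _) ej (proj1 (oklr 0 _ _ jS)) // addnS.
  by move=> /eqP ->.
exists u => //.
have start j : j <= S -> X 0 j = column_of (conf u 0) j.
  move=> jS; have /and3P[/eqP st /forallP lr s] := init j jS.
  rewrite /X [LHS]surjective_pairing st; congr (_, _); apply/ffunP => i.
  rewrite !ffunE /=; have /andP[/eqP l_i] := lr i.
  rewrite [LHS]surjective_pairing l_i; case: eqP => [-> _|_ /= /eqP ->];
    last first.
    by rewrite /= nth_nil.
  rewrite /= nth_nil; congr (_, _).
  move: s; rewrite (nth_start j le_u); case ki: (init_kind j) => [[a|]|] /=.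
  - by move/eqP.
  - have [j' ej j'B] : exists2 j', j = size x + j' & j' < B.
      move: ki; rewrite /init_kind nth_cat size_map; case: ltnP => [lt_j|le_j].
        by case: x lt_j => // a0 s0 lt_j; rewrite (nth_map a0).
      rewrite nth_nseq; case: ltnP => // lt_B _; exists (j - size x) => //.
      by rewrite subnKC.
    rewrite ej addKn -fu // /f j'B -ej /X.
    case: (((w_here (ch (0, j))).2 ord0).2) => [y|] // /existsP[b /eqP[->]].
    by rewrite (inj_eq (@tm_in_inj _ _ M)); case: b.
  - by move/eqP.
have steps t : t <= T -> forall j, j + t <= S -> X t j = column_of (conf u t) j.
  elim: t => [_ j|t IH tT j jS]; first by rewrite addn0; apply: start.
  have tT' := ltnW tT; rewrite addnS in jS.
  rewrite okn //; last by lia.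
  rewrite /conf iterS -/(conf u t) -next_column_window.
  have ez : w_zero (ch (t, j)) = column_of (conf u t) 0.
    by rewrite okz ?IH //; lia.
  have eh : w_here (ch (t, j)) = column_of (conf u t) j by rewrite -IH //; lia.
  have er : w_right (ch (t, j)) = column_of (conf u t) j.+1.
    by have [|-> _] := oklr t j tT'; rewrite ?IH //; lia.
  have -> : ch (t, j) = (w_zero (ch (t, j)), w_left (ch (t, j)), w_here (ch (t,
    j)),
      w_right (ch (t, j))) by case: (ch (t, j)) => [[[]]].
  rewrite ez eh er; case: j jS {eh er ez} => [|j] jS; first exact: next_column0.
  have [|_ ->] := oklr t j tT'; first by lia.
  by rewrite IH //; lia.
have := okb T 0 (leqnn T) (leq0n S);
  rewrite /bad /= eqxx /= 2!negb_or => /and3P[_ _].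
rewrite negbK (@accepts_conf u) //; apply: steps => //.
by rewrite add0n /S -addnA leq_addr.
Qed.

End Tableau.

(** * NP-hardness *)

Lemma PF_odd (S : ctype) (n : S -> nat) : PF n -> PF (fun x => odd (n x)).
Proof.
move=> Pn; apply: (PF_ext (f := fun x => iter (n x) negb false)).
  by move=> x; elim: (n x) => //= m ->.
apply: (@PF_iter _ _ (fun _ => negb)) => //; last exact: PF_const.
  by apply: PF_negb; apply: PF_snd.
exists 2 => x a m; apply: (@leq_trans (2 ^ 2)); last exact: leq_expl.
by case: (iter m negb a : bool).
Qed.

Lemma PF_half (S : ctype) (n : S -> nat) : PF n -> PF (fun x => (n x)./2).
Proof.
move=> Pn; apply: (PF_ext (f := fun x => count odd (iota 0 (n x)))).
  move=> x; elim: (n x) => // m IH.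
  by rewrite -addn1 iotaD count_cat IH /= addn0 add0n addn1 /= uphalf_half addnC.
apply: PF_count; last exact: PF_iota.
by apply: PF_odd; apply: PF_snd.
Qed.

Ltac pf_user ::= match goal with
  | |- PF (fun _ => odd _) => apply: PF_odd
  | |- PF (fun _ => half _) => apply: PF_half
  end.

Lemma sz_nat (n : nat) : sz n = n.*2.+1.
Proof. by rewrite /sz; elim: n => // n; rewrite doubleS /= => ->. Qed.

Lemma PF_bits (S : ctype) (n : S -> nat) : PF n -> PF (fun x => bits (n x)).
Proof.
pose step (p : seq bool * nat) :=
  if p.2 == 0 then p else (odd p.2 :: p.1, p.2./2).
have itE m u k : (iter m step (u, k)).1 = rev (bits_rec m k) ++ u.
  elim: m u k => // m IH u k; rewrite iterSr /step /=.
  case: eqP => [->|_]; last by rewrite IH rev_cons cat_rcons.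
  by rewrite IH; case: m {IH}.
move=> Pn; apply: (PF_ext (f := fun x => rev (iter (n x) step ([::], n x)).1)).
  by move=> x; rewrite itE cats0 revK.
apply: PF_rev; apply: PF_fst'.
apply: (@PF_iter _ _ (fun _ => step) (fun x => ([::], n x))) => //; last by pf.
  by rewrite /step; pf.
have [k bk] : pbound (fun n => n + 4 * n) by auto.
exists k => x [u m] i; apply: leq_trans (bk _).
suff szi : sz (iter i step (u, m)) <= sz (u, m) + 4 * i.
  apply: leq_trans szi _; apply: leq_add; last by rewrite leq_mul2l /= leq_addl.
  by rewrite -addnA addnCA leq_addr.
elim: i => [|i]; first by rewrite addn0.
rewrite iterS; case: (iter i step _) => v l IH; rewrite /step /=.
case: eqP => [_|_]; first by apply: leq_trans IH _;
  rewrite leq_add2l leq_mul2l leqnSn.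
move: IH; rewrite !sz_pair sz_cons !sz_nat.
have : sz (odd l) <= 3 by case: odd.
have : l./2 <= l by lia.
rewrite -!muln2; lia.
Qed.

Lemma PF_rcons (S T : ctype) (f : S -> T) (s : S -> seq T) :
  PF f -> PF s -> PF (fun x => rcons (s x) (f x)).
Proof.
move=> Pf Ps; apply: (PF_ext (f := fun x => s x ++ [:: f x])).
  by move=> x; rewrite cats1.
by pf.
Qed.

Lemma PF_join_words (S : ctype) (s : S -> seq (seq bool)) :
  PF s -> PF (fun x => join_words (s x)).
Proof.
move=> Ps; rewrite /join_words; apply: PF_flatten; apply: PF_map => //.
apply: PF_rcons; first exact: PF_const.
apply: (@PF_map _ bool_ctype option_bool_ctype (fun _ b => Some b));
  last exact: PF_snd.
apply: (PF_ext (f := fun p => if p.2 then Some true else Some false)).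
  by case=> ? [].
by apply: PF_if (@PF_snd _ _) _ _; apply: PF_const.
Qed.

Lemma PF_horner (S : ctype) (p : {poly nat}) (n : S -> nat) :
  PF n -> PF (fun x => p.[n x]%R).
Proof.
move=> Pn; rewrite /horner; elim: (polyseq p) => [|a s IH] /=;
  first exact: PF_const.
apply: (PF_ext (f := fun x => horner_rec s (n x) * n x + a)) => //.
by pf.
Qed.

Lemma leq_horner (p : {poly nat}) m n : m <= n -> p.[m]%R <= p.[n]%R.
Proof.
rewrite /horner => le_mn; elim: (polyseq p) => //= a s IH.
by rewrite !natrE leq_add2r leq_mul.
Qed.

(** * The reduction is computable in polynomial time *)

Section Reduction.
Variables (A : finType) (M : tm (A + bool)%type bool).
Local Notation W := (window M).
Local Notation env := (seq A * (nat * nat))%type.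
Local Notation cell := (nat * nat * W)%type.

Lemma PF_fin2' (S : ctype) (D1 D2 : finType) (T : ctype) (h : D1 -> D2 -> T)
    (f : S -> D1) (g : S -> D2) :
  PF f -> PF g -> PF (fun x => h (f x) (g x)).
Proof. by apply: PF_comp2; apply: PF_fin2. Qed.

Lemma PF_init_kind : PF (fun p : env * nat =>
  init_kind p.1.1 p.1.2.1 p.2).
Proof.
rewrite /init_kind; apply: PF_nth; last exact: PF_snd.
apply: PF_cat.
  apply: PF_map; last by pf.
  apply: (PF_comp (g := fun a : A => Some (Some a) : content A)); last by pf.
  exact: PF_fin.
by apply: PF_nseq; pf.
Qed.

Lemma PF_bad : PF (fun p : env * cell =>
  bad p.1.1 p.1.2.1 p.1.2.2 p.2.1 p.2.2).
Proof.
rewrite /bad; apply: PF_orb.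
  apply: PF_andb; first by pf.
  by apply: (PF_comp (g := fun w : W => w_zero w != w_here w));
    [apply: PF_fin|pf].
apply: PF_orb; (apply: PF_andb; first by pf); apply: PF_negb.
  apply: PF_fin2'; last by pf.
  by apply: (PF_comp PF_init_kind (f := fun p : env * cell => (p.1, p.2.1.2)));
    pf.
by apply: (PF_comp (g := fun w : W => accepts w)); [apply: PF_fin|pf].
Qed.

Lemma PF_clash : PF (fun p : env * (cell * cell) =>
  clash p.1.1 p.1.2.1 p.1.2.2 p.2.1 p.2.2).
Proof.
(* The index [j] is unbounded, but [next_column j] only distinguishes 0, 1 and larger values, so
   three fixed tables on pairs of windows replace it. *)
pose f (p : env * (cell * cell)) : bool :=
  let w := p.2.1.2 in let w' := p.2.2.2 in
  let t := p.2.1.1.1 in let t' := p.2.2.1.1 in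
  let j := p.2.1.1.2 in let j' := p.2.2.1.2 in
  [|| bad p.1.1 p.1.2.1 p.1.2.2 p.2.1.1 w,
      (t == t') && (j' == 0) && (w_zero w != w_here w'),
      (t == t') && (j' == j.+1) && ((w_right w != w_here w') || (w_left w' != w_here w)) |
      (t' == t.+1) && (j == j') && (if j == 0 then next_column 0 w != w_here w' else
        if j == 1 then next_column 1 w != w_here w' else next_column 2 w != w_here w')].
apply: (PF_ext (f := f)).
  case=> -[x [B T]] [[[t j] w] [[t' j'] w']]; rewrite /f /=.
  by case: j => [|[|j]].
have Pw : PF (fun p : env * (cell * cell) => p.2.1.2) by pf.
have Pw' : PF (fun p : env * (cell * cell) => p.2.2.2) by pf.
have fin2 (h : W -> W -> bool) : PF (fun p : env * (cell * cell) =>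
  h p.2.1.2 p.2.2.2).
  exact: PF_fin2'.
rewrite /f; apply: PF_orb.
  by apply: (PF_comp PF_bad (f := fun p : env * (cell * cell) => (p.1, p.2.1)));
    pf.
apply: PF_orb; first by apply: PF_andb;
  [pf | exact: (fin2 (fun w w' => w_zero w != w_here w'))].
apply: PF_orb; apply: PF_andb; try by pf.
  exact: (fin2 (fun w w' => (w_right w != w_here w') || (w_left w' != w_here w))).
apply: PF_if; first by pf.
  exact: (fin2 (fun w w' => next_column 0 w != w_here w')).
apply: PF_if; first by pf.
  exact: (fin2 (fun w w' => next_column 1 w != w_here w')).
exact: (fin2 (fun w w' => next_column 2 w != w_here w')).
Qed.

Lemma PF_allpairs (S T1 T2 U : ctype) (f : S -> T1 -> T2 -> U) (s : S -> seq T1)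
    (t : S -> T1 -> seq T2) :
  PF (fun p : S * T1 * T2 => f p.1.1 p.1.2 p.2) -> PF s ->
  PF (fun p : S * T1 => t p.1 p.2) ->
  PF (fun x => [seq f x y z | y <- s x, z <- t x y]).
Proof.
move=> Pf Ps Pt; apply: PF_flatten; apply: PF_map => //.
exact: (@PF_map _ _ _ (fun (q : S * T1) z => f q.1 q.2 z)).
Qed.

Lemma PF_cells : PF (fun p : env => cells p.1 p.2.1 p.2.2).
Proof. by apply: PF_allpairs; pf. Qed.

Variable w0 : W.
Local Notation vertex := (nat * cell)%type.
Local Notation V p := (vertices (cells p.1 p.2.1 p.2.2) (enum W) (0, 0) w0).
Local Notation H p := (hubs (cells p.1 p.2.1 p.2.2) (enum W) (0, 0) w0).

Lemma PF_layers ks : PF (fun p : env =>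
  layers (cells p.1 p.2.1 p.2.2) (enum W) (0, 0) w0 ks : seq vertex).
Proof.
have Pc : PF (fun p : env * nat => cells p.1.1 p.1.2.1 p.1.2.2).
  by apply: (PF_comp PF_cells (f := fst)); exact: PF_fst.
apply: PF_allpairs; [by pf | by pf |]; rewrite /layer.
apply: PF_if; first by pf.
  by apply: PF_map => //; pf.
apply: PF_if; first by pf.
  exact: PF_const.
by apply: PF_allpairs => //; pf.
Qed.

(** Equality of vertices is split into equalities of numbers and one of windows, the latter being a
    table. *)
Lemma PF_adj : PF (fun p : env * (vertex * vertex) =>
  adj (clash p.1.1 p.1.2.1 p.1.2.2) p.2.1 p.2.2).
Proof.
pose f (p : env * (vertex * vertex)) : bool :=
  let a := p.2.1 in let b := p.2.2 in
  if ~~ odd a.1 && ~~ odd b.1 then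
    ~~ ((a.1 == b.1) && ((a.2.1.1 == b.2.1.1) && (a.2.1.2 == b.2.1.2)
                         && (a.2.2 == b.2.2)))
    && ~~ ((a.1 == 0) && (b.1 == 4) || (a.1 == 4) && (b.1 == 0))
  else if (a.1 == 3) && (b.1 == 3) then
    ~~ ((a.2.1.1 == b.2.1.1) && (a.2.1.2 == b.2.1.2)) &&
    (clash p.1.1 p.1.2.1 p.1.2.2 a.2 b.2 || clash p.1.1 p.1.2.1 p.1.2.2 b.2 a.2)
  else ((a.1 == 3) && (b.1 == 0) && ((a.2.1.1 == b.2.1.1) &&
    (a.2.1.2 == b.2.1.2))
      || (a.1 == 1) && (b.1 == 4)) ||
    ((b.1 == 3) && (a.1 == 0) && ((b.2.1.1 == a.2.1.1) && (b.2.1.2 == a.2.1.2))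
      || (b.1 == 1) && (a.1 == 4)).
apply: (PF_ext (f := f)).
  by case=> -[x [B T]] [[i [[t j] w]] [i' [[t' j'] w']]].
have Peq : PF (fun p : env * (vertex * vertex) => p.2.1.2.2 == p.2.2.2.2).
  by apply: (@PF_fin2' _ W W _ (fun w w' => w == w')); pf.
rewrite /f; apply: PF_if; first by pf.
  apply: PF_andb; last by pf.
  apply: PF_negb; apply: PF_andb; first by pf.
  by apply: PF_andb => //; pf.
apply: PF_if; [by pf | | by pf].
apply: PF_andb; first by pf.
apply: PF_orb.
  apply: (PF_comp PF_clash
    (f := fun p : env * (vertex * vertex) => (p.1, (p.2.1.2, p.2.2.2)))); pf.
apply: (PF_comp PF_clash
  (f := fun p : env * (vertex * vertex) => (p.1, (p.2.2.2, p.2.1.2)))); pf.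
Qed.

Definition graph_word (p : env) : seq (option bool) :=
  join_words (bits_int (size (H p))%:Z ::
    [seq [seq adj (clash p.1 p.2.1 p.2.2) a b | b <- V p] | a <- V p] ++ [:: [::]]).

Lemma PF_graph_word : PF graph_word.
Proof.
have PV : PF (fun p : env => V p) by apply: PF_layers.
apply: PF_join_words; apply: PF_cons.
  apply: (PF_ext (f := fun p : env => false :: bits (size (H p)))) => //.
  apply: PF_cons; first exact: PF_const.
  apply: PF_bits; exact: (PF_size (PF_layers [:: 0; 2; 4])).
apply: PF_cat; last exact: PF_const.
apply: PF_map => //.
apply: (@PF_map _ _ _ (fun (q : env * vertex) b =>
  adj (clash q.1.1 q.1.2.1 q.1.2.2) q.2 b)).
  apply: (PF_comp PF_adj (f := fun q => (q.1.1, (q.1.2, q.2)))); pf.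
by apply: (PF_comp PV (f := fst)); exact: PF_fst.
Qed.

End Reduction.

(** Membership in the language only yields some instance with the given code; this carries the
    answer over to the instance that the reduction built. *)
Lemma yes_instance_encode I J :
  encode I = encode J -> yes_instance I -> yes_instance J.
Proof.
case/encode_inj; rewrite /yes_instance.
case: I => s ? ? q ? n e ? ? k; case: J => s' ? ? q' ? n' e' ? ? k' /= -> en.
subst n'; move=> /adj_rows_inj ee _ ss.
have -> : s = s' by apply: functional_extensionality.
suff -> : e = e' by [].
by apply: functional_extensionality => i; apply: functional_extensionality => j.
Qed.

Lemma sequence_b_coloring_hard : NP_hard sequence_b_coloring.
Proof.
move=> A L [V [p [[d [M [pt Mout]] Vd] Lp]]].
(* [T x] bounds the running time on all certificates of size at most [B x] at once, by monotonicity
   of polynomials over [nat]; the successor makes it positive. *)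
pose B (x : seq A) := p.[size x]%R;
  pose T (x : seq A) := (pt.[size x + B x]%R).+1.
pose w0 : window M :=
  let c := (tm_init M, [ffun=> (None, None)]) in (c, c, c, c).
exists (fun x => graph_word w0 (x, (B x, T x))).
  apply: polytime_of_PF; apply: (PF_comp (PF_graph_word w0)).
  have PB : PF (fun x : seq A => B x).
    by apply: (PF_horner p (n := fun x : seq A => size x)); pf.
  apply: PF_pair; first by pf.
  apply: PF_pair => //; apply: PF_succ.
  apply: (PF_horner pt (n := fun x : seq A => size x + B x)).
  exact: (PF_addn (PF_size (PF_id _)) PB).
move=> x.
have out u : size u <= B x -> tm_outputs_in M (T x) (pair_word x u) [:: d (pair_word x u)].
  move=> le_u; have le_T : pt.[size (pair_word x u)]%R <= T x.
    apply: leqW; apply: leq_horner.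
    by rewrite size_cat !size_map leq_add2l.
  have [halted out] := Mout (pair_word x u);
    rewrite /tm_outputs_in -(subnK le_T) iterD.
  suff -> k c : tm_halt c.1 -> iter k (@tm_step _ _ M) c = c by [].
  by elim: k => //= k IH hc; rewrite IH // /tm_step hc.
have cells2 : 0 < size (cells x (B x) (T x)) by rewrite size_allpairs !size_iota.
have uniq_cells : uniq (cells x (B x) (T x)).
  by apply: allpairs_uniq => [||[? ?] [? ?]]; rewrite ?iota_uniq.
have W_gt0 : 0 < size (enum (window M)) by rewrite -cardE; apply/card_gt0P;
  exists w0.
have [I eI yesI] := csp_instance (clash x (B x) (T x)) (0, 0) w0 uniq_cells
  (enum_uniq _) cells2 W_gt0.
split=> [/Lp[u le_u /Vd du]|[J eJ yesJ]].
  exists I; first exact: esym.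
  by apply/yesI; apply: (solvable_of_certificate out le_u du).
have : yes_instance I by apply: yes_instance_encode yesJ; rewrite eI -eJ.
case/yesI/(certificate_of_solution (isT : 0 < T x) out) => u le_u du.
by apply/Lp; exists u => //; apply/Vd.
Qed.

(** * Binary words *)

Lemma bits_rec_fuel m n : n <= m -> bits_rec m n = bits n.
Proof.
suff rec k : forall m l, k <= m -> k <= l -> bits_rec m k = bits_rec l k.
  by move=> le_nm; apply: rec.
elim/ltn_ind: k => -[|k] IH [|m'] [|l] //= km kl.
by congr (_ :: _); apply: IH; lia.
Qed.

Lemma bits_cons (x : bool) m : 0 < x + m.*2 -> bits (x + m.*2) = x :: bits m.
Proof.
case e: (x + m.*2) => [|n] // _; rewrite /bits [bits_rec _ _]/=.
have -> : ~~ odd n = x by rewrite -[~~ _]/(odd n.+1) -e oddD odd_double addbF oddb.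
have hm : uphalf n = m by rewrite -[uphalf n]/(n.+1./2) -e half_bit_double.
by rewrite hm bits_rec_fuel // -hm leq_uphalf_double -addnn; lia.
Qed.

(** The most significant bit comes last and must be [true]; by the default value the empty word,
    which is the code of 0, is canonical. *)
Definition canon (b : seq bool) := head true (rev b).

Lemma canonE b : canon b = last true b.
Proof. by case/lastP: b => // s x; rewrite /canon rev_rcons last_rcons. Qed.

Lemma unbits_gt0 b : canon b -> b != [::] -> 0 < unbits b.
Proof.
rewrite canonE; elim: b => // x [|y b] IH /=; first by case: x.
by move=> can _; have := IH can isT; rewrite /=; lia.
Qed.

Lemma canon_bits b : canon b -> bits (unbits b) = b.
Proof.
elim: b => // x b IH can; rewrite [unbits _]/= bits_cons;
  last exact: unbits_gt0 can _.
rewrite IH //; move: can; rewrite !canonE /=; by case: b {IH}.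
Qed.

Lemma bits_canon n : canon (bits n).
Proof.
rewrite canonE; elim/ltn_ind: n => n IH.
case: (posnP n) => [->//|n_gt0]; rewrite -(odd_double_half n) bits_cons;
  last first.
  by rewrite odd_double_half.
have /IH : n./2 < n by lia.
case eb: (bits n./2) => [|y b] //= _.
have h0 : n./2 = 0 by rewrite -[LHS]bitsK eb.
by case: n {IH} n_gt0 h0 {eb} => [|[|n]].
Qed.

(** The scan starts at the least significant bit, so the last difference, which is the most
    significant one, decides. No unary value of a possibly exponential number is formed. *)
Definition lebits (a b : seq bool) : bool :=
  foldl (fun res i => if nth false a i == nth false b i then res else nth false b i)
    true (iota 0 (size a + size b)).

Lemma lebitsE a b : lebits a b = (unbits a <= unbits b).
Proof.
(* The initial [res] is made arbitrary for the induction; it decides when the two numbers are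
   equal. *)
suff rec m res c d : size c <= m -> size d <= m ->
    foldl (fun res i => if nth false c i == nth false d i then res else nth false d i)
      res (iota 0 m) =
    (unbits c < unbits d) || (unbits c == unbits d) && res.
  by rewrite /lebits rec ?leq_addr ?leq_addl // andbT orbC -leq_eqVlt.
elim: m res c d => [|m IH] res c d; first by case: c d => [|? ?] [|? ?].
have unE s : unbits s = (head false s) + (unbits (behead s)).*2 by case: s.
move=> cm dm; rewrite [iota _ _]/= -add1n iotaDl /=.
rewrite (unE c) (unE d) !nth0; move: (IH
  (if head false c == head false d then res else head false d)
  (behead c) (behead d)); rewrite !size_behead.
have fm f r s : foldl f r [seq 1 + i | i <- s] = foldl (fun r i =>
  f r i.+1) r s :> bool.
  by elim: s r => //= i s IHs r; rewrite IHs.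
rewrite fm.
have -> : (fun r i => if nth false c i.+1 == nth false d i.+1 then r
    else nth false d i.+1) =
  (fun r i => if nth false (behead c) i == nth false (behead d) i then r
    else nth false (behead d) i).
  by do 2 apply: functional_extensionality => ?; rewrite !nth_behead.
move=> -> //; try lia.
case: (head false c); case: (head false d) => /=; case: res; lia.
Qed.

Lemma PF_lebits (S : ctype) (a b : S -> seq bool) :
  PF a -> PF b -> PF (fun x => lebits (a x) (b x)).
Proof.
apply: PF_comp2; apply: (@PF_foldl _ _ _
  (fun (p : seq bool * seq bool) res i => if nth false p.1 i == nth false p.2 i
    then res else nth false p.2 i) (fun=> true)).
- by pf.
- exists 2 => x a' s; apply: (@leq_trans (2 ^ 2)); last exact: leq_expl.
  by case: (foldl _ _ _ : bool).
- by pf.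
- by pf.
Qed.

Definition split_step (o : option bool) (ws : seq (seq bool)) :=
  if o is Some b then (b :: head [::] ws) :: behead ws else [::] :: ws.

Definition split_words : seq (option bool) -> seq (seq bool) :=
  foldr split_step [::].

Lemma join_wordsK : cancel join_words split_words.
Proof.
elim=> // w ws IH; rewrite /join_words /= /split_words foldr_cat -/(join_words ws).
rewrite -/split_words IH; elim: w => //= b w ->; by [].
Qed.

Lemma PF_isSome (S : ctype) (o : S -> option bool) : PF o -> PF (fun x =>
  isSome (o x)).
Proof. by apply: PF_comp; apply: (@PF_fin _ _ (fun o : option bool =>
  isSome o)). Qed.

Lemma PF_odflt (S : ctype) (o : S -> option bool) b :
  PF o -> PF (fun x => odflt b (o x)).
Proof. by apply: PF_comp; apply: (@PF_fin _ _ (fun o : option bool =>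
  odflt b o)). Qed.

Ltac pf_user ::= lazymatch goal with
  | |- PF (fun _ => isSome _) => apply: PF_isSome
  | |- PF (fun _ => Option.default _ _) => apply: PF_odflt
  end.

Lemma PF_split_words (S : ctype) (s : S -> seq (option bool)) :
  PF s -> PF (fun x => split_words (s x)).
Proof.
move=> Ps; rewrite /split_words;
  apply: (@PF_foldr _ _ _ (fun _ => split_step) (fun=> [::])) => //.
- apply: (PF_ext (f := fun p => if isSome p.1.2 then
      (odflt false p.1.2 :: head [::] p.2) :: behead p.2 else [::] :: p.2)).
    by case=> -[x [b|]] ws.
  by pf.
- have [k bk] : pbound (fun n => n + 6 * n) by auto.
  exists k => x a t; apply: leq_trans (bk _).
  suff szf : sz (foldr split_step a t) <= sz a + 6 * size t.
    apply: leq_trans szf _; apply: leq_add;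
      first by rewrite -addnA addnCA leq_addr.
    rewrite leq_mul2l /=; apply: ltnW; apply: leq_trans (size_sz t) _;
      exact: leq_addl.
  elim: t => [|o t IH]; first by rewrite addn0.
  rewrite /= mulnS addnCA; apply: leq_trans (_ : 6 + sz (foldr split_step a t) <= _);
    last by rewrite leq_add2l.
  move: (foldr _ _ _) => ws {IH}; case: o => [b|];
    last by rewrite /= sz_cons sz_nil; lia.
  have szb : sz b <= 3 by case: b.
  by case: ws => [|v ws]; rewrite /= !sz_cons ?sz_nil; lia.
- by pf.
Qed.

(** * The verifier *)

Section Words.
(* [ws] are the words of an encoded instance, and [cs] unary words: the colors of
   the vertices, followed by the number of colors. *)
Variables ws cs : seq (seq bool).

(** Word 0 is the integer, the next [wn] words are the rows of the matrix, then come the empty word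
    and the [wq] terms of the sequence. *)
Definition wn := size (nth [::] ws 1).
Definition we (i j : nat) := nth false (nth [::] ws i.+1) j.
Definition wq := size ws - wn.+2.
(** The word [[:: true]] is [bits 1], so [sequence_ok] also compares the last listed term with the
    constant tail. *)
Definition wsv (i : nat) : seq bool :=
  if i < wq then nth [::] ws (wn.+2 + i) else [:: true].
Definition wsign := head false (nth [::] ws 0).
Definition wabs := behead (nth [::] ws 0).
Definition wcol (i : nat) := size (nth [::] cs i).
Definition wr := wcol wn.

Definition grow (R : seq nat) : seq nat :=
  [seq v <- iota 0 wn | has (fun u => (u == v) || we u v) R].

Definition reached : seq nat := iter wn grow [:: 0].

(** The last clause excludes a negative zero, which [bits_int] never produces. *)
Definition shape_ok : bool :=
  [&& 0 < wn, wn.+2 <= size ws,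
      all (fun i => size (nth [::] ws i.+1) == wn) (iota 0 wn),
      size (nth [::] ws wn.+1) == 0,
      0 < size (nth [::] ws 0), canon wabs & wsign ==> (0 < size wabs)].

Definition sequence_ok : bool :=
  all (fun i => [&& canon (wsv i), 0 < size (wsv i) & lebits (wsv i.+1) (wsv i)])
    (iota 0 wq).

Definition graph_ok : bool :=
  all (fun i => [&& ~~ we i i, has (fun v => v == i) reached &
    all (fun j => we i j == we j i) (iota 0 wn)]) (iota 0 wn).

Definition wcdv (i : nat) : bool :=
  all (fun c => (wcol i == c) || has (fun j => we i j &&
    (wcol j == c)) (iota 0 wn))
    (iota 0 wr).

Definition coloring_ok : bool :=
  [&& all (fun i => wcol i < wr) (iota 0 wn),
      all (fun i => all (fun j => we i j ==> ~~ (wcol i == wcol j)) (iota 0 wn))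
        (iota 0 wn),
      all (fun c => lebits (wsv c)
          (bits (count (fun i => (wcol i == c) &&
            wcdv i) (iota 0 wn)))) (iota 0 wr) &
      wsign || lebits wabs (bits wr)].

Definition verify_words : bool :=
  [&& shape_ok, sequence_ok, graph_ok & coloring_ok].

End Words.

Local Notation words := (seq (seq bool)).

Section WordsPF.
Variable S : ctype.
Implicit Types (w c : S -> words) (i j : S -> nat).

Lemma PF_wn w : PF w -> PF (fun x => wn (w x)).
Proof. by move=> Pw; rewrite /wn; pf. Qed.

Lemma PF_we w i j : PF w -> PF i -> PF j -> PF (fun x => we (w x) (i x) (j x)).
Proof. by move=> Pw Pi Pj; rewrite /we; pf. Qed.

Lemma PF_wcol c i : PF c -> PF i -> PF (fun x => wcol (c x) (i x)).
Proof. by move=> Pc Pi; rewrite /wcol; pf. Qed.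

End WordsPF.

Ltac pf_user ::= lazymatch goal with
  | |- PF (fun _ => bits _) => apply: PF_bits
  | |- PF (fun _ => lebits _ _) => apply: PF_lebits
  | |- PF (fun _ => wn _) => apply: PF_wn
  | |- PF (fun _ => we _ _ _) => apply: PF_we
  | |- PF (fun _ => wcol _ _) => apply: PF_wcol
  end.

Lemma PF_wsv (S : ctype) (w : S -> words) (i : S -> nat) :
  PF w -> PF i -> PF (fun x => wsv (w x) (i x)).
Proof. by move=> Pw Pi; rewrite /wsv /wq; pf. Qed.

Lemma sz_filter (T : ctype) (p : pred T) (s : seq T) : sz (filter p s) <= sz s.
Proof.
by elim: s => //= x s IH; case: ifP => _; rewrite !sz_cons //; lia.
Qed.

Lemma PF_reached : PF reached.
Proof.
have Piota : PF (fun w : words => iota 0 (wn w)).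
  by apply: PF_iota; apply: PF_wn; apply: PF_id.
apply: (@PF_iter _ _ grow (fun=> [:: 0]) wn); [|  |by pf|].
- by rewrite /grow; pf.
- have [k szi] := sz_PF Piota.
  have [l bl] : pbound (fun n => n + n.+2 ^ k) by auto.
  exists l => w R m; apply: leq_trans (bl _).
  case: m => [|m].
    by rewrite addn0; apply: leq_trans (leq_addr _ _); apply: leq_addl.
  apply: leq_trans (leq_addl _ _); apply: leq_trans (sz_filter _ _) _.
  apply: leq_trans (leq_trans (leqW (leqnSn _)) (szi w)) _.
  by apply: leq_expl; rewrite !ltnS -addnA leq_addr.
- by apply: PF_wn; apply: PF_id.
Qed.

Lemma PF_wcdv (S : ctype) (w c : S -> words) (i : S -> nat) :
  PF w -> PF c -> PF i -> PF (fun x => wcdv (w x) (c x) (i x)).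
Proof.
move=> Pw Pc Pi; apply: (@PF_comp _ (prod_ctype (prod_ctype _ _) _) _
  (fun p : words * words * nat => wcdv p.1.1 p.1.2 p.2)
  (fun x => ((w x, c x), i x))); last by pf.
by rewrite /wcdv /wr; pf.
Qed.

Lemma PF_verify_words : PF (fun p : words * words => verify_words p.1 p.2).
Proof.
have Preached : PF (fun p : words * words * nat => reached p.1.1).
  by apply: (PF_comp PF_reached (f := fun p : words * words * nat => p.1.1));
    pf.
apply: PF_andb; [|apply: PF_andb; [|apply: PF_andb]].
- by rewrite /shape_ok /canon /wabs /wsign; pf.
- rewrite /sequence_ok /wq; apply: PF_all; last by pf.
  rewrite /canon; do ?apply: PF_andb; try by pf.
  + by apply: PF_head; apply: PF_rev; apply: PF_wsv; pf.
  + by apply: PF_leq; [pf|]; apply: PF_size; apply: PF_wsv; pf.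
  + by apply: PF_lebits; apply: PF_wsv; pf.
- rewrite /graph_ok; apply: PF_all; last by pf.
  by do ?apply: PF_andb; pf.
- rewrite /coloring_ok /wr /wabs /wsign; do ?apply: PF_andb; try by pf.
  apply: PF_all; last by pf.
  apply: PF_lebits; first by apply: PF_wsv; pf.
  apply: PF_bits; apply: PF_count; last by pf.
  by apply: PF_andb; [pf | apply: PF_wcdv; pf].
Qed.

Canonical certified_ctype :=
  CType (fun d : (option bool + bool)%type => enc_nat (enum_rank d)).

Definition lefts (z : seq (option bool + bool)) : seq (option bool) :=
  flatten [seq if y is inl o then [:: o] else [::] | y <- z].

Definition rights (z : seq (option bool + bool)) : seq bool :=
  flatten [seq if y is inr b then [:: b] else [::] | y <- z].

Lemma lefts_pair w u : lefts (pair_word w u) = w.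
Proof.
rewrite /lefts /pair_word map_cat flatten_cat -!map_comp.
rewrite (_ : flatten (map _ u) = [::]) ?cats0; last by elim: u.
by elim: w => //= o w ->.
Qed.

Lemma rights_pair w u : rights (pair_word w u) = u.
Proof.
rewrite /rights /pair_word map_cat flatten_cat -!map_comp.
rewrite (_ : flatten (map _ w) = [::]) /=; last by elim: w.
by elim: u => //= o u ->.
Qed.

Definition eq_bit_words (a b : seq (option bool)) : bool :=
  (size a == size b) && all (fun i => nth None a i == nth None b i) (iota 0 (size a)).

Lemma eq_bit_wordsP a b : reflect (a = b) (eq_bit_words a b).
Proof.
apply: (iffP andP) => [[/eqP sz_ab /allP eq_ab]|->].
  apply: (@eq_from_nth _ None) => // i lt_i; apply/eqP/eq_ab.
  by rewrite mem_iota.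
by split=> //; apply/allP.
Qed.

(** [split_words] accepts every word; joining again rejects a nonempty word that does not end with a
    separator. *)
Definition verify (z : seq (option bool + bool)%type) : bool :=
  let ws := split_words (lefts z) in
  eq_bit_words (lefts z) (join_words ws) &&
  verify_words ws (split_words [seq if b then Some true else None | b <- rights z]).

Lemma PF_verify : PF (verify : seq (option bool + bool)%type -> bool).
Proof.
have Pl : PF (lefts : seq (option bool + bool)%type -> seq (option bool)).
  apply: PF_flatten.
  apply: (@PF_map _ (fin_ctype (option bool + bool)%type) (seq_ctype option_bool_ctype)
     (fun _ y => if y is inl o then [:: o] else [::])); last exact: PF_id.
  apply: (PF_comp (g := fun y : (option bool + bool)%type =>
     if y is inl o then [:: o] else [::])); last exact: PF_snd.
  exact: PF_fin.
have Pr : PF (rights : seq (option bool + bool)%type -> seq bool).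
  apply: PF_flatten.
  apply: (@PF_map _ (fin_ctype (option bool + bool)%type) (seq_ctype bool_ctype)
     (fun _ y => if y is inr b then [:: b] else [::])); last exact: PF_id.
  apply: (PF_comp (g := fun y : (option bool + bool)%type =>
     if y is inr b then [:: b] else [::])); last exact: PF_snd.
  exact: PF_fin.
have Peq (S : ctype) (a b : S -> seq (option bool)) :
    PF a -> PF b -> PF (fun x => eq_bit_words (a x) (b x)).
  apply: PF_comp2; apply: PF_andb; first by pf.
  apply: PF_all; last by pf.
  apply: (@PF_comp2 _ _ _ _ (fun o o' : option bool => o == o')); try by pf.
  exact: (@PF_fin2 _ _ _ (fun o o' : option bool => o == o')).
have Pws : PF (fun z : seq (option bool + bool)%type => split_words (lefts z)).
  exact: PF_split_words.
apply: PF_andb; first by apply: Peq => //; apply: PF_join_words.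
apply: (PF_comp2 PF_verify_words Pws); apply: PF_split_words.
apply: (@PF_map _ bool_ctype option_bool_ctype
  (fun _ b => if b then Some true else None)) => //.
by apply: PF_if; [apply: PF_snd | apply: PF_const | apply: PF_const].
Qed.

(** Certificates are words over [bool]: colors are written in unary with [true], which leaves
    [false] as the separator. *)
Definition unary_cert (cs : words) : seq bool := map isSome (join_words cs).

Lemma unary_certK (cs : words) : all (all id) cs ->
  [seq if b then Some true else None | b <- unary_cert cs] = join_words cs.
Proof.
rewrite /unary_cert -map_comp => all1; rewrite -[RHS]map_id;
  apply/eq_in_map => o.
case/flattenP => v /mapP[c cC ->]; rewrite mem_rcons inE => /orP[/eqP -> //|].
by case/mapP => b bc -> /=; have /allP/(_ _ cC)/allP/(_ _ bc) := all1;
  case: b {bc}.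
Qed.

Lemma verify_pair w (cs ws : words) : all (all id) cs -> w = join_words ws ->
  verify_words ws cs -> verify (pair_word w (unary_cert cs)).
Proof.
move=> cs1 -> ok; rewrite /verify lefts_pair rights_pair unary_certK //.
by rewrite !join_wordsK ok andbT; apply/eq_bit_wordsP.
Qed.

Lemma verify_pairP w u : verify (pair_word w u) ->
  exists ws cs, w = join_words ws /\ verify_words ws cs.
Proof.
rewrite /verify lefts_pair => /andP[/eq_bit_wordsP e ok].
by exists (split_words w); eexists; split; [exact: e | exact: ok].
Qed.

(** * NP-completeness *)

Section IotaOrd.
Variables (n : nat) (P : pred nat).

Lemma all_iotaP : reflect (forall i : 'I_n, P i) (all P (iota 0 n)).
Proof.
apply: (iffP allP) => [h i|h i]; first by apply: h; rewrite mem_iota ltn_ord.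
by rewrite mem_iota => /andP[_ lt_i]; exact: (h (Ordinal lt_i)).
Qed.

Lemma has_iotaP : reflect (exists i : 'I_n, P i) (has P (iota 0 n)).
Proof.
apply: (iffP hasP) => [[i]|[i Pi]]; last by exists (val i) => //;
  rewrite mem_iota ltn_ord.
by rewrite mem_iota => /andP[_ lt_i] Pi; exists (Ordinal lt_i).
Qed.

Lemma card_iota : #|[set i : 'I_n | P i]| = count P (iota 0 n).
Proof.
rewrite cardsE -sum1_card -sum1_count.
by rewrite -[X in iota 0 X]subn0 -/(index_iota 0 n) big_mkord.
Qed.

End IotaOrd.

Section WordsOfGraph.
Variables (ws cs : seq (seq bool)) (n : nat) (e : rel 'I_n).
Hypothesis wnE : wn ws = n.
Hypothesis weE : forall i j : 'I_n, we ws i j = e i j.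

Lemma mem_reached k (i0 v : 'I_n) : i0 = 0 :> nat ->
  val v \in iter k (grow ws) [:: 0] -> connect e i0 v.
Proof.
move=> i00; elim: k v => [|k IH] v.
  rewrite inE => /eqP v0; rewrite (_ : v = i0) ?connect0 //; apply: val_inj.
    exact: etrans v0 (esym i00).
rewrite iterS mem_filter => /andP[/hasP[u uR uv] _].
have lt_u : u < n.
  case: k {IH} uR => [|k]; first by rewrite inE => /eqP ->;
    apply: leq_ltn_trans (ltn_ord v).
  by rewrite iterS mem_filter mem_iota wnE => /and3P[].
have := IH (Ordinal lt_u) uR => /connect_trans; apply.
case/orP: uv => [/eqP uv|uv]; last by apply: connect1; rewrite -weE.
by rewrite (_ : Ordinal lt_u = v) ?connect0 //; apply: val_inj.
Qed.

Lemma reached_path k (i0 : 'I_n) p : i0 = 0 :> nat -> path e i0 p ->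
  size p <= k ->
  val (last i0 p) \in iter k (grow ws) [:: 0].
Proof.
move=> i00; elim: k p => [|k IH] p.
  by case: p => // _ _; rewrite inE /= i00.
have mono (v : 'I_n) : val v \in iter k (grow ws) [:: 0] ->
    val v \in iter k.+1 (grow ws) [:: 0].
  move=> vR; rewrite iterS mem_filter mem_iota wnE ltn_ord andbT.
  by apply/andP; split=> //; apply/hasP; exists (val v); rewrite ?eqxx.
case/lastP: p => [_ _|p v]; first exact: mono (IH [::] isT (leq0n k)).
rewrite rcons_path last_rcons size_rcons => /andP[pp pv] sz_p.
rewrite iterS mem_filter mem_iota wnE ltn_ord andbT.
apply/andP; split=> //; apply/hasP; exists (val (last i0 p)); first exact: IH.
by rewrite weE pv orbT.
Qed.

Lemma reachedP (i0 : 'I_n) : i0 = 0 :> nat ->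
  (forall v : 'I_n, has (fun u => u == v :> nat) (reached ws)) <-> forall v,
    connect e i0 v.
Proof.
move=> i00; have hasE (v : 'I_n) : has (fun u =>
  u == v :> nat) (reached ws) = (val v \in reached ws).
  by rewrite -has_pred1.
split=> con v; first by apply: (@mem_reached (wn ws)) => //; rewrite -hasE.
(* A path without repetition has at most [n] vertices, so [n] rounds of [grow] reach its end. *)
rewrite hasE; have /connectP[p pp ->] := con v; case/shortenP: pp => q qq uq _.
apply: reached_path => //; rewrite wnE -ltnS.
by have := card_uniqP uq; have := max_card (mem (i0 :: q));
  rewrite card_ord /= => + <-; apply: leqW.
Qed.

Section Colors.
Variables (r : nat) (c : {ffun 'I_n -> 'I_r}).
Hypothesis wrE : wr ws cs = r.
Hypothesis colE : forall i : 'I_n, wcol cs i = c i.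
Hypothesis used : used_colors c = [set: 'I_r].

Lemma wcdvE (i : 'I_n) : wcdv ws cs i = (i \in CDV e c).
Proof.
rewrite inE used /wcdv wrE wnE; apply/all_iotaP/subsetP => [h q _|h q].
  have /orP[/eqP ci|/has_iotaP[j /andP[eij /eqP cj]]] := h q.
    by apply/imsetP; exists i; [rewrite inE eqxx | apply: val_inj;
      rewrite /= -colE].
  apply/imsetP; exists j; first by rewrite inE -weE eij orbT.
  by apply: val_inj; rewrite /= -colE.
have /imsetP[j] := h q (in_setT _); rewrite inE => /orP[/eqP -> ->|eij ->].
  by rewrite colE eqxx.
by apply/orP; right; apply/has_iotaP; exists j; rewrite weE eij colE eqxx.
Qed.

Lemma count_CDV (q : 'I_r) :
  count (fun i => (wcol cs i == q) && wcdv ws cs i) (iota 0 n) =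
  #|color_class c q :&: CDV e c|.
Proof.
rewrite -card_iota; apply: eq_card => i.
by rewrite in_setI -wcdvE [i \in color_class _ _]inE [LHS]inE colE.
Qed.

End Colors.
End WordsOfGraph.

Lemma words_split (ws : seq (seq bool)) : (wn ws).+2 <= size ws ->
  ws = nth [::] ws 0 :: [seq nth [::] ws i.+1 | i <- iota 0 (wn ws)] ++
    nth [::] ws (wn ws).+1 :: [seq nth [::] ws ((wn ws).+2 + i) | i <- iota 0 (wq ws)].
Proof.
move=> le_sz; rewrite -[LHS](take_size ws) -(map_nth_iota0 [::] (leqnn _)).
rewrite (_ : size ws = 1 + (wn ws + (1 + wq ws))); last by rewrite /wq; lia.
have map_iota (f : nat -> seq bool) m k :
    map f (iota m k) = [seq f (m + i) | i <- iota 0 k].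
  by rewrite -[in LHS](addn0 m) iotaDl -map_comp.
rewrite !iotaD !map_cat; congr (_ :: _ ++ _ :: _); rewrite map_iota.
  exact: eq_map.
by apply: eq_map => i; rewrite add0n addn1.
Qed.

(** Since an [instance] carries proofs of its side conditions, the verifier has to establish them
    for the bare word: positive non-increasing terms, a simple connected graph, and canonical
    numerals so that the encoding gives back the same word. *)
Lemma instance_of_words ws cs : verify_words ws cs ->
  exists2 I, join_words ws = encode I & yes_instance I.
Proof.
case/and4P => /and5P[n_gt0 le_sz rows nil /andP[h_gt0 /andP[can_k sgn_k]]].
move=> /all_iotaP seq_ok /all_iotaP g_ok /and4P[col_lt col_proper col_count k_ok].
pose n := wn ws; pose e : rel 'I_n := fun i j => we ws i j.
pose s i := unbits (wsv ws i).
have seqP i : i < wq ws -> [/\ canon (wsv ws i),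
  0 < size (wsv ws i) & s i.+1 <= s i].
  by move=> lt_i; have /and3P[? ?] := seq_ok (Ordinal lt_i); rewrite lebitsE.
have tail i : wq ws <= i -> s i = 1.
  by move=> le_i; rewrite /s /wsv ltnNge le_i.
have s_gt0 i : 0 < s i.
  have [/seqP[can sz _]|/tail -> //] := ltnP i (wq ws).
  by apply: unbits_gt0; rewrite // -size_eq0 -lt0n.
have s_step i : s i.+1 <= s i.
  by have [/seqP[]//|le_i] := ltnP i (wq ws); rewrite !tail // leqW.
have s_noninc i j : i <= j -> s j <= s i.
  elim: j => [|j IH]; first by rewrite leqn0 => /eqP ->.
  rewrite leq_eqVlt => /orP[/eqP -> //|/IH]; apply: leq_trans; exact: s_step.
have e_sym : symmetric e.
  by move=> i j; have /and3P[_ _ /all_iotaP/(_ j)/eqP] := g_ok i.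
have e_irr : irreflexive e.
  by move=> i; have /and3P[/negbTE] := g_ok i.
pose i0 : 'I_n := Ordinal n_gt0.
have e_con : connected_graph e.
  split; first by rewrite card_ord.
  have con v : connect e i0 v.
    have h := @reachedP ws n e erefl (fun _ _ => erefl) i0 erefl.
    by move: v; apply/h => v; have /and3P[] := g_ok v.
  by move=> v v'; apply: connect_trans (con v');
    rewrite (sym_connect_sym e_sym).
pose k : int := (if wsign ws then - (unbits (wabs ws))%:Z else (unbits (wabs ws))%:Z)%R.
have bits_k : bits_int k = nth [::] ws 0.
  have -> : nth [::] ws 0 = wsign ws :: wabs ws.
    by rewrite /wsign /wabs; case: (nth _ _ 0) h_gt0.
  rewrite /bits_int /k; move: sgn_k; case sg: (wsign ws) => /= sz_k.
    have u_gt0 : 0 < unbits (wabs ws) by apply: unbits_gt0;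
      rewrite // -size_eq0 -lt0n.
    by rewrite Num.Theory.oppr_lt0 ltz_nat u_gt0 abszN absz_nat canon_bits.
  by rewrite canon_bits.
exists (@Instance s s_gt0 s_noninc (wq ws) tail n e (conj e_sym e_irr) e_con k).
  rewrite /encode /= bits_k [in LHS](words_split le_sz).
  rewrite (size0nil (eqP nil)); congr (join_words (_ :: _ ++ _ :: _)).
    rewrite /adj_rows -val_enum_ord -map_comp; apply: eq_map => i /=.
    have /all_iotaP/(_ i)/eqP sz_i := rows.
    rewrite -[LHS]take_size -(map_nth_iota0 false (leqnn _)) sz_i -val_enum_ord.
    by rewrite -map_comp.
  apply/eq_in_map => i; rewrite mem_iota => /andP[_ lt_i].
  have [can_i _ _] := seqP i lt_i.
  by rewrite /s canon_bits // /wsv lt_i.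
apply/phi_geP => /=; exists (wr ws cs); last first.
  rewrite /k; case sg: (wsign ws) k_ok => /= k_ok.
    by apply: (@Order.POrderTheory.le_trans _ _ 0%R) => //;
      rewrite Num.Theory.oppr_le0.
  by rewrite lebitsE bitsK in k_ok; rewrite lez_nat.
have /all_iotaP lt_r := col_lt.
pose c := [ffun i : 'I_n => Ordinal (lt_r i)].
have colE (i : 'I_n) : wcol cs i = c i by rewrite ffunE.
have classes (q : 'I_(wr ws cs)) : s q <=
    count (fun i => (wcol cs i == q) && wcdv ws cs i) (iota 0 n).
  by have /all_iotaP/(_ q) := col_count; rewrite lebitsE bitsK.
have used : used_colors c = setT.
  apply/setP => q; rewrite inE; apply/imsetP.
  have := leq_trans (s_gt0 q) (classes q); rewrite -has_count.
  case/has_iotaP => i /andP[/eqP ci _]; exists i => //.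
  by apply: val_inj; rewrite /= -colE.
have classE := @count_CDV ws cs n e erefl (fun _ _ =>
  erefl) _ c erefl colE used.
apply/existsP; exists c; rewrite used eqxx /=; apply/andP; split; last first.
  by apply/forallP => q; rewrite -classE.
apply/andP; split; last first.
  apply/forallP => q; apply/implyP => _; rewrite -card_gt0 -classE.
  exact: leq_trans (s_gt0 q) (classes q).
apply/forallP => i; apply/forallP => j; apply/implyP => eij.
have /all_iotaP/(_ i)/all_iotaP/(_ j)/implyP/(_ eij) := col_proper.
by rewrite !colE.
Qed.

Lemma row_adj n (e : rel 'I_n) (i : 'I_n) rest :
  nth [::] (adj_rows e ++ rest) i = [seq e i j | j <- enum 'I_n].
Proof.
rewrite nth_cat size_adj_rows ltn_ord (nth_map i) ?size_enum_ord //.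
by rewrite nth_ord_enum.
Qed.

Definition instance_words (I : instance) : seq (seq bool) :=
  bits_int (inst_k I) :: adj_rows (@inst_e I) ++
    [::] :: [seq bits (inst_s I i) | i <- iota 0 (inst_q I)].

Definition coloring_words n r (c : {ffun 'I_n -> 'I_r}) : seq (seq bool) :=
  [seq nseq (c i) true | i <- enum 'I_n] ++ [:: nseq r true].

Lemma verify_instance (I : instance) r (c : {ffun 'I_(inst_n I) -> 'I_r}) :
  b_coloring (@inst_e I) c -> used_colors c = setT ->
  (forall i : 'I_r, inst_s I i <= #|color_class c i :&: CDV (@inst_e I) c|) ->
  (inst_k I <= r%:Z)%R ->
  verify_words (instance_words I) (coloring_words c).
Proof.
case: I c => s s_gt0 s_ni q tail n e [e_sym e_irr] [n_gt0 con] k /= c.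
move=> /andP[proper _] used classes kr.
set I := Instance _ _ _ _ _ _; set ws := instance_words I;
  set cs := coloring_words c.
have nz : 0 < n by rewrite -(card_ord n).
pose i0 := Ordinal nz.
have wsS i : nth [::] ws i.+1 = nth [::] (adj_rows e ++
    [::] :: [seq bits (s i) | i <- iota 0 q]) i by [].
have wnE : wn ws = n.
  by rewrite /wn wsS -[0]/(val i0) row_adj size_map size_enum_ord.
have weE (i j : 'I_n) : we ws i j = e i j.
  by rewrite /we wsS row_adj (nth_map i) ?size_enum_ord // nth_ord_enum.
have wqE : wq ws = q.
  rewrite /wq wnE /ws /instance_words /= size_cat size_adj_rows /= size_map size_iota.
  lia.
have wsvE i : unbits (wsv ws i) = s i /\ canon (wsv ws i).
  rewrite /wsv wqE wnE; case: ltnP => [lt_i|/tail -> //].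
  rewrite (_ : n.+2 + i = (n + i.+1).+1); last by lia.
  rewrite wsS nth_cat size_adj_rows ltnNge leq_addr /= addKn /=.
  by rewrite (nth_map 0) ?size_iota // nth_iota // add0n bitsK bits_canon.
have colE (i : 'I_n) : wcol cs i = c i.
  rewrite /wcol /cs /coloring_words nth_cat size_map size_enum_ord ltn_ord.
  by rewrite (nth_map i) ?size_enum_ord // nth_ord_enum size_nseq.
have wrE : wr ws cs = r.
  rewrite /wr wnE /wcol /cs /coloring_words nth_cat size_map size_enum_ord.
  by rewrite ltnn subnn size_nseq.
have classE := count_CDV wnE weE wrE colE used.
have wsignE : wsign ws = (k < 0)%R by [].
have wabsE : wabs ws = bits `|k| by [].
apply/and4P; split.
- apply/and3P; split; first by rewrite wnE.
    by rewrite wnE /ws /instance_words /= size_cat size_adj_rows /=; lia.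
  apply/and5P; split=> //.
  + rewrite wnE; apply/all_iotaP => i.
    by rewrite wsS row_adj size_map size_enum_ord.
  + by rewrite wnE wsS nth_cat size_adj_rows ltnn subnn.
  + by rewrite wabsE bits_canon.
  + rewrite wabsE wsignE; apply/implyP => k_lt0; rewrite lt0n size_eq0;
      apply/eqP => /(congr1 unbits); rewrite bitsK /=.
    by lia.
- apply/all_iotaP => i; have [ei ci] := wsvE i; have [eSi cSi] := wsvE i.+1.
  rewrite ci lebitsE ei eSi s_ni // andbT lt0n size_eq0.
  by apply/eqP => wsv0; have := s_gt0 i; rewrite -ei wsv0.
- have h := @reachedP ws n e wnE weE i0 erefl.
  rewrite /graph_ok wnE; apply/all_iotaP => i; rewrite weE e_irr /=.
  rewrite (proj2 h (con i0)) /=.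
  by apply/all_iotaP => j; rewrite !weE e_sym.
rewrite /coloring_ok wnE wrE; apply/and4P; split.
- by apply/all_iotaP => i; rewrite colE.
- apply/all_iotaP => i /=; apply/all_iotaP => j; rewrite weE !colE.
  by have /forallP/(_ i)/forallP/(_ j) := proper.
- by apply/all_iotaP => q'; rewrite lebitsE bitsK classE (wsvE q').1.
rewrite wsignE wabsE lebitsE !bitsK.
by move: kr; lia.
Qed.

Lemma leq_size_join ws : size ws <= size (join_words ws).
Proof.
elim: ws => // w ws IH; rewrite /join_words /= size_cat size_rcons addSn ltnS.
exact: leq_trans IH (leq_addl _ _).
Qed.

Lemma size_join_leq m ws : all (fun w => size w <= m) ws ->
  size (join_words ws) <= size ws * m.+1.
Proof.
elim: ws => //= w ws IH /andP[le_w /IH le_ws].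
by rewrite /join_words /= size_cat size_rcons size_map mulSn leq_add.
Qed.

Lemma sequence_b_coloring_NP : in_NP sequence_b_coloring.
Proof.
(* The certificate consists of [n + 1] unary words of length at most [n], each with a separator,
   where [n] is the number of vertices; the number of colors is at most [n], and [n] at most the
   length of the input. *)
exists (fun z => verify z), (('X + 1) ^+ 2)%R; split.
  exists verify => //; apply: polytime_of_PF.
  (* The output letters are coded by [fin_ctype bool] and the test by [bool_ctype]; choosing between
     two constant words passes from one to the other. *)
  apply: (@PF_ext (seq_ctype certified_ctype) (seq_ctype (fin_ctype bool))
    (fun z => if verify z then [:: true] else [:: false])).
    by move=> z; case: (verify z).
  exact: PF_if PF_verify (PF_const _ _) (PF_const _ _).
move=> w; split=> [[I -> /phi_geP[r sr kr]]|[u _ /verify_pairP[ws [cs [-> ok]]]]].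
  have le_rn := realizes_le_card sr; rewrite card_ord in le_rn.
  have [c /and3P[bc /eqP used /forallP classes]] := existsP sr.
  exists (unary_cert (coloring_words c)); last first.
    apply: (@verify_pair _ _ (instance_words I)) => //;
      last exact: verify_instance.
    rewrite all_cat /= all_nseq orbT !andbT; apply/allP => b /mapP[i _ ->].
    by rewrite all_nseq orbT.
  rewrite /unary_cert size_map horner_exp hornerD hornerX hornerC !natrE.
  have le_n : inst_n I <= size (encode I).
    apply: leq_trans (leq_size_join _); rewrite /= size_cat size_adj_rows; lia.
  apply: leq_trans (size_join_leq (m := inst_n I) _) _.
    rewrite all_cat /= size_nseq le_rn !andbT; apply/allP => b /mapP[i _ ->].
    by rewrite size_nseq (leq_trans (ltnW (ltn_ord _)) le_rn).
  rewrite size_cat size_map size_enum_ord -mulnn [size [:: _]]/= !addn1.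
  exact: leq_mul.
have [I eI yesI] := instance_of_words ok.
by exists I; rewrite // eI.
Qed.

Theorem theorem3p3 : NP_complete sequence_b_coloring.
Proof. by split; [apply: sequence_b_coloring_NP | apply: sequence_b_coloring_hard]. Qed.
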